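(* Let $\alpha\in(0,1)$ and let $\varphi\in\mathcal D_\alpha$ be an analytic self-map of $\mathbb D$. If $\|\varphi\|_\infty<1$, then $D_\varphi$ is compact on $\mathcal D_\alpha$.
   Context: $\mathbb D=\{z\in\mathbb C:|z|<1\}$ and $\mathcal H(\mathbb D)$ is the space of complex-valued holomorphic functions on $\mathbb D$. An analytic self-map of $\mathbb D$ is a $\varphi\in\mathcal H(\mathbb D)$ with $\varphi(\mathbb D)\subseteq\mathbb D$, and $\|\varphi\|_\infty=\sup_{z\in\mathbb D}|\varphi(z)|$. The weighted Dirichlet space $\mathcal D_\alpha$ consists of all $f(z)=\sum_{n\ge0}a_nz^n\in\mathcal H(\mathbb D)$ with $\sum_{n\ge0}(n+1)^{1-\alpha}|a_n|^2<\infty$; it is a Hilbert space with inner product $\langle f,g\rangle_{\mathcal D_\alpha}=\sum_{n\ge0}(n+1)^{1-\alpha}a_n\overline{b_n}$ for $g(z)=\sum_{n\ge0} b_nz^n$. The composition-differentiation operator is $D_\varphi f=f'\circ\varphi$; ''compact on $\mathcal D_\alpha$'' means that $D_\varphi$ maps $\mathcal D_\alpha$ into itself as a compact linear operator. *)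

(* Defs.v *)
From HB Require Import structures.
From mathcomp Require Import all_boot all_order all_algebra.
From mathcomp Require Import all_classical all_reals all_analysis.
From mathcomp Require Import complex.
From mathcomp Require Import ring lra.

Set Implicit Arguments.
Unset Strict Implicit.
Unset Printing Implicit Defensive.

Import Order.TTheory GRing.Theory Num.Theory.
Import numFieldNormedType.Exports.

Local Open Scope classical_set_scope.
Local Open Scope ring_scope.
Local Open Scope complex_scope.

(* The library puts the topology of the absolute value on R[i]^o; it is copied
   to R[i], so that derivatives of functions R[i] -> R[i] are complex ones. *)
HB.instance Definition _ (R : realType) := NormedModule.copy R[i] R[i]^o.

(* `|z| : R[i] is the absolute value inside R[i]; normc z : R is the same
   number as a real. *)
Notation normc := ComplexField.Normc.normc.

Definition unit_disc (R : realType) : set R[i] := [set z | `|z| < 1].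
Arguments unit_disc : clear implicits.

Definition holomorphic_on_disc (R : realType) (f : R[i] -> R[i]) :=
  forall z, unit_disc R z -> derivable f z 1.

Definition analytic_self_map (R : realType) (phi : R[i] -> R[i]) :=
  holomorphic_on_disc phi /\ forall z, unit_disc R z -> unit_disc R (phi z).

(* sup is 0 on unbounded sets: only meaningful for f bounded on the disc, in
   particular for self-maps. *)
Definition disc_sup_norm (R : realType) (f : R[i] -> R[i]) : R :=
  sup [set normc (f z) | z in unit_disc R].

Definition power_series_on_disc (R : realType)
    (f : R[i] -> R[i]) (a : nat -> R[i]) :=
  forall z, unit_disc R z ->
    series (fun n => a n * z ^+ n : R[i]) @ \oo --> (f z : R[i]).

(* The power series is unique (power_series_on_disc_uniq), so that taylor_coef f
   is a as soon as power_series_on_disc f a holds (taylor_coefE). *)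
Definition taylor_coef (R : realType) (f : R[i] -> R[i]) : nat -> R[i] :=
  xget (fun=> 0) [set a | power_series_on_disc f a].

Definition dirichlet_weight (R : realType) (alpha : R) (n : nat) : R :=
  n.+1%:R `^ (1 - alpha).

Definition square_summable (R : realType) (alpha : R) (a : nat -> R[i]) :=
  cvgn (series (fun n => dirichlet_weight alpha n * normc (a n) ^+ 2)).

Definition in_dirichlet (R : realType) (alpha : R) (f : R[i] -> R[i]) :=
  holomorphic_on_disc f /\
  exists2 a, power_series_on_disc f a & square_summable alpha a.

Definition dirichlet_pred (R : realType) (alpha : R) : {pred (R[i] -> R[i])} :=
  [pred f | `[< in_dirichlet alpha f /\
                forall z, ~ unit_disc R z -> f z = 0 >]].

Section SequenceNorm.
Context {R : realType} (alpha : R).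
Local Notation C := R[i].
Implicit Types (a b : nat -> C) (f g : C -> C) (z : C).

Let w := dirichlet_weight alpha.

Lemma dirichlet_weight_gt0 n : 0 < w n.
Proof. by rewrite powR_gt0. Qed.

Lemma normC_normc (z : C) : `|z| = (normc z)%:C.
Proof. by case: z. Qed.

Lemma normc_ge0 (z : C) : 0 <= normc z.
Proof. by rewrite -ler0c -normC_normc. Qed.

Lemma normcD_le (x y : C) : normc (x + y) <= normc x + normc y.
Proof. exact: le_normcD. Qed.

Lemma disc_normc z : unit_disc R z = (normc z < 1) :> Prop.
Proof. by rewrite /unit_disc /= normC_normc (_ : 1 = 1%:C) // ltcR. Qed.

Lemma cvgn_normc (u : nat -> C) (l : C) : u @ \oo --> l ->
  forall e : R, 0 < e -> \forall n \near \oo, normc (u n - l) < e.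
Proof.
move=> /cvgrPdist_lt ul e e0.
have := ul e%:C; rewrite ltcR => /(_ e0); apply: filterS => n /=.
by rewrite distrC normC_normc ltcR.
Qed.

Lemma cvgn_realC (u : nat -> R) (l : R) : u @ \oo --> l ->
  (fun n => (u n)%:C : C) @ \oo --> (l%:C : C).
Proof.
move=> /cvgrPdist_lt ul; apply/cvgrPdist_lt => e e0.
have eE : e = (complex.Re e)%:C by rewrite RRe_real// gtr0_real.
have e0' : 0 < complex.Re e by rewrite -ltcR -eE.
apply: filterS (ul _ e0') => n; rewrite eE -rmorphB normC_normc ltcR => h.
by rewrite /normc /= expr0n /= addr0 sqrtr_sqr.
Qed.

Let term a n := w n * normc (a n) ^+ 2.

Let term_ge0 a n : 0 <= term a n.
Proof. by rewrite mulr_ge0 ?sqr_ge0 // ltW // dirichlet_weight_gt0. Qed.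

Definition seq_sqnorm a : R := limn (series (term a)).

Let sn := seq_sqnorm.

Let nd a : nondecreasing_seq (series (term a)).
Proof. by apply: nondecreasing_series => n _ _; exact: term_ge0. Qed.

Lemma seq_sqnorm_partial a n : square_summable alpha a ->
  series (term a) n <= sn a.
Proof. by move=> sa; apply: nondecreasing_cvgn_le => //; exact: nd. Qed.

Lemma seq_sqnorm_bound a M : (forall n, series (term a) n <= M) ->
  square_summable alpha a /\ sn a <= M.
Proof.
move=> aM; have sa : square_summable alpha a.
  by apply: nondecreasing_is_cvgn; [exact: nd|exists M => _ [n _ <-]].
by split => //; apply: limr_le => //; near=> n; exact: aM.
Unshelve. all: by end_near. Qed.

Lemma seq_sqnorm_ge0 a : square_summable alpha a -> 0 <= sn a.
Proof. by move=> /(seq_sqnorm_partial 0); rewrite /series /= big_geq. Qed.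

Lemma seq_sqnorm_eq0 a : square_summable alpha a -> sn a = 0 ->
  forall n, a n = 0.
Proof.
move=> sa sa0 n; apply: ComplexField.Normc.eq0_normc; apply/eqP.
have := seq_sqnorm_partial n.+1 sa; rewrite sa0 seriesSr.
have : 0 <= series (term a) n by apply: sumr_ge0 => i _; exact: term_ge0.
move=> h1 h2; have : term a n <= 0 by lra.
rewrite /term pmulr_rle0 ?dirichlet_weight_gt0// => h.
by rewrite -sqrf_eq0 eq_le h sqr_ge0.
Qed.

Lemma square_summable0 : square_summable alpha (fun=> 0).
Proof.
apply: (proj1 (@seq_sqnorm_bound _ 0 _)) => n; rewrite /series /= big1// => i _.
by rewrite /term ComplexField.Normc.normc0 expr0n mulr0.
Qed.

Lemma square_summableZ (c : C) a : square_summable alpha a ->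
  square_summable alpha (fun n => c * a n) /\
  sn (fun n => c * a n) = normc c ^+ 2 * sn a.
Proof.
move=> sa.
have E : series (term (fun n => c * a n)) =
    (fun n => normc c ^+ 2 * series (term a) n).
  apply/funext => n; rewrite /series /= mulr_sumr; apply: eq_bigr => i _.
  by rewrite /term ComplexField.Normc.normcM exprMn mulrCA.
have h : series (term (fun n => c * a n)) @ \oo --> normc c ^+ 2 * sn a.
  by rewrite E; apply: cvgMr; exact: sa.
split; first by apply/cvg_ex; exists (normc c ^+ 2 * sn a).
exact: cvg_lim h.
Qed.

Let weighted_sqD (x y : C) (t : R) : 0 < t ->
  normc (x + y) ^+ 2 <= (1 + t) * normc x ^+ 2 + (1 + t^-1) * normc y ^+ 2.
Proof.
move=> t0; apply: (@le_trans _ _ ((normc x + normc y) ^+ 2)).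
  by rewrite lerXn2r ?nnegrE ?addr_ge0 ?normc_ge0 ?normcD_le.
rewrite -subr_ge0.
have -> : (1 + t) * normc x ^+ 2 + (1 + t^-1) * normc y ^+ 2
    - (normc x + normc y) ^+ 2 = t^-1 * (t * normc x - normc y) ^+ 2.
  by field; rewrite gt_eqF.
by rewrite mulr_ge0 ?sqr_ge0// invr_ge0 ltW.
Qed.

Lemma square_summableD_weighted a b t : 0 < t ->
  square_summable alpha a -> square_summable alpha b ->
  square_summable alpha (fun n => a n + b n) /\
  sn (fun n => a n + b n) <= (1 + t) * sn a + (1 + t^-1) * sn b.
Proof.
move=> t0 sa sb; apply: seq_sqnorm_bound => n.
have t1 : 0 < t^-1 by rewrite invr_gt0.
apply: (@le_trans _ _
  ((1 + t) * series (term a) n + (1 + t^-1) * series (term b) n)).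
  rewrite /series /= !mulr_sumr -big_split /=; apply: ler_sum => i _.
  rewrite [leRHS](_ : _ = w i * ((1 + t) * normc (a i) ^+ 2
    + (1 + t^-1) * normc (b i) ^+ 2)); last by rewrite /term; ring.
  by rewrite ler_pM2l ?dirichlet_weight_gt0// weighted_sqD.
apply: lerD; apply: ler_wpM2l; rewrite ?seq_sqnorm_partial//; lra.
Qed.

Lemma square_summableD a b :
  square_summable alpha a -> square_summable alpha b ->
  square_summable alpha (fun n => a n + b n).
Proof. by move=> sa sb; case: (square_summableD_weighted ltr01 sa sb). Qed.

Lemma seq_norm_triangle a b :
  square_summable alpha a -> square_summable alpha b ->
  Num.sqrt (sn (fun n => a n + b n)) <= Num.sqrt (sn a) + Num.sqrt (sn b).
Proof.
move=> sa sb.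
have [a0|aN0] := eqVneq (sn a) 0.
  rewrite a0 sqrtr0 add0r (_ : (fun n => a n + b n) = b)//.
  by apply/funext => n; rewrite (seq_sqnorm_eq0 sa a0) add0r.
have [b0|bN0] := eqVneq (sn b) 0.
  rewrite b0 sqrtr0 addr0 (_ : (fun n => a n + b n) = a)//.
  by apply/funext => n; rewrite (seq_sqnorm_eq0 sb b0) addr0.
have a0 : 0 < sn a by rewrite lt_neqAle eq_sym aN0 seq_sqnorm_ge0.
have b0 : 0 < sn b by rewrite lt_neqAle eq_sym bN0 seq_sqnorm_ge0.
set A := Num.sqrt (sn a); set B := Num.sqrt (sn b).
have A0 : 0 < A by rewrite sqrtr_gt0.
have B0 : 0 < B by rewrite sqrtr_gt0.
have [_] := square_summableD_weighted (divr_gt0 B0 A0) sa sb.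
have -> : sn a = A ^+ 2 by rewrite sqr_sqrtr// ltW.
have -> : sn b = B ^+ 2 by rewrite sqr_sqrtr// ltW.
have -> : (1 + B / A) * A ^+ 2 + (1 + (B / A)^-1) * B ^+ 2 = (A + B) ^+ 2.
  by field; rewrite !gt_eqF.
move=> h; rewrite -(@ger0_norm _ (A + B)); last by rewrite addr_ge0 // ltW.
by rewrite -sqrtr_sqr ler_wsqrtr.
Qed.

End SequenceNorm.

Section PowerSeries.
Context {R : realType}.
Local Notation C := R[i].
Implicit Types (a b : nat -> C) (f g : C -> C) (z : C).

Lemma power_series_on_disc0 :
  power_series_on_disc (fun=> 0 : C) (fun=> 0).
Proof.
move=> z _; rewrite (_ : series _ = fun=> 0); first exact: cvg_cst.
by apply/funext => n; rewrite /series /= big1// => i _; rewrite mul0r.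
Qed.

Lemma power_series_on_discD f g a b :
  power_series_on_disc f a -> power_series_on_disc g b ->
  power_series_on_disc (fun z => f z + g z) (fun n => a n + b n).
Proof.
move=> fa gb z zD; rewrite (_ : series _ =
  series (fun n => a n * z ^+ n) \+ series (fun n => b n * z ^+ n)).
  by apply: cvgD; [exact: fa|exact: gb].
apply/funext => n; rewrite /series /= -big_split; apply: eq_bigr => i _.
by rewrite mulrDl.
Qed.

Lemma power_series_on_discZ (c : C) f a : power_series_on_disc f a ->
  power_series_on_disc (fun z => c * f z) (fun n => c * a n).
Proof.
move=> fa z zD; rewrite (_ : series _ =
  (fun n => c * series (fun n => a n * z ^+ n) n)).
  by apply: cvgMr; exact: fa.
apply/funext => n; rewrite /series /= mulr_sumr; apply: eq_bigr => i _.
by rewrite mulrA.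
Qed.

Let coef_bound a : power_series_on_disc (fun=> 0) a ->
  exists2 M : R, 0 < M & forall n, normc (a n) <= M * 2 ^+ n.
Proof.
move=> a0; set h : C := (2^-1 : R)%:C.
have nh : normc h = 2^-1.
  by rewrite /normc /= expr0n /= addr0 sqrtr_sqr ger0_norm.
have hD : unit_disc R h by rewrite disc_normc nh; lra.
have := cvgn_normc (a0 _ hD) ltr01; rewrite nearE /= => -[N _ HN].
have tail n : (N <= n)%N -> normc (a n) <= 2 * 2 ^+ n.
  move=> Nn; have h1 := HN n Nn; have h2 := HN n.+1 (leqW Nn).
  rewrite /= !subr0 in h1 h2.
  have E : a n * h ^+ n =
      series (fun k => a k * h ^+ k) n.+1 + (-1) * series (fun k => a k * h ^+ k) n.
    by rewrite seriesSr mulN1r addrAC subrr add0r.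
  have : normc (a n * h ^+ n) <= 2.
    rewrite E (le_trans (normcD_le _ _))// ComplexField.Normc.normcM.
    by rewrite normcN ComplexField.Normc.normc1 mul1r; lra.
  have -> : normc (a n * h ^+ n) = normc (a n) / 2 ^+ n.
    rewrite ComplexField.Normc.normcM -exprVn; congr (_ * _).
    elim: (n) => [|m IH]; first by rewrite !expr0 ComplexField.Normc.normc1.
    by rewrite !exprS ComplexField.Normc.normcM IH nh.
  by rewrite ler_pdivrMr// exprn_gt0.
have S0 : 0 <= \sum_(i < N) normc (a i) by apply: sumr_ge0 => i _; exact: normc_ge0.
exists (2 + \sum_(i < N) normc (a i)); first lra.
move=> n; have [Nn|nN] := leqP N n.
  apply: (le_trans (tail _ Nn)); rewrite ler_wpM2r ?exprn_ge0//; lra.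
have h1 : normc (a n) <= \sum_(i < N) normc (a i).
  rewrite (bigD1 (Ordinal nN))//= lerDl sumr_ge0// => i _; exact: normc_ge0.
have h2 : 1 <= 2 ^+ n :> R by rewrite exprn_ege1// ler1n.
apply: (@le_trans _ _ (2 + \sum_(i < N) normc (a i))); first lra.
by rewrite ler_peMr//; lra.
Qed.

Lemma power_series_on_disc_inj0 a :
  power_series_on_disc (fun=> 0) a -> forall n, a n = 0.
Proof.
move=> a0; have [M M0 aM] := coef_bound a0.
elim/ltn_ind => n IH; apply: contrapT => /eqP anN0.
set r := normc (a n).
have r0 : 0 < r.
  rewrite lt_neqAle normc_ge0 andbT eq_sym; apply: contra anN0 => /eqP.
  by move/ComplexField.Normc.eq0_normc => ->.
set K := M * 2 ^+ n; have K0 : 0 < K by rewrite mulr_gt0// exprn_gt0.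
pose t : R := r / (8 * (K + r)).
have Kr : 0 < K + r by lra.
have t0 : 0 < t by rewrite divr_gt0// mulr_gt0.
have tE : t * (8 * (K + r)) = r by rewrite divfK// gt_eqF// mulr_gt0.
have t1 : t < 8^-1.
  by rewrite ltr_pdivrMr ?mulr_gt0//; lra.
have Kt : 8 * (K * t) <= r by rewrite -[leRHS]tE; nra.
clearbody t.
have nt : normc (t%:C : C) = t.
  by rewrite /normc /= expr0n /= addr0 sqrtr_sqr ger0_norm// ltW.
have ntX k : normc ((t%:C : C) ^+ k) = t ^+ k.
  elim: k => [|m IHm]; first by rewrite !expr0 ComplexField.Normc.normc1.
  by rewrite !exprS ComplexField.Normc.normcM IHm nt.
have tD : unit_disc R t%:C by rewrite disc_normc nt; lra.
have e0 : 0 < t ^+ n * (r / 2) by rewrite mulr_gt0 ?exprn_gt0//; lra.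
have := cvgn_normc (a0 _ tD) e0; rewrite nearE /= => -[N _ HN].
have := HN (n.+1 + N)%N (leq_addl _ _); rewrite /= subr0.
have sn : series (fun k => a k * t%:C ^+ k) n.+1 = a n * t%:C ^+ n.
  rewrite seriesSr /series /= big_nat big1 ?add0r// => i /andP[_ ni].
  by rewrite IH// mul0r.
pose rest m := series (fun k => a k * t%:C ^+ k) (n.+1 + m)%N
  - a n * t%:C ^+ n.
have restb m : normc (rest m) <=
    t ^+ n * (4 * (K * t)) * (1 - (2 * t) ^+ m).
  elim: m => [|m IHm].
    by rewrite /rest addn0 sn subrr ComplexField.Normc.normc0 expr0 subrr mulr0.
  rewrite /rest addnS seriesSr addrAC (le_trans (normcD_le _ _))//.
  have h1 : normc (a (n.+1 + m)%N * t%:C ^+ (n.+1 + m)) <=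
      t ^+ n * (2 * (K * t)) * (2 * t) ^+ m.
    rewrite ComplexField.Normc.normcM ntX.
    apply: (le_trans (ler_wpM2r (exprn_ge0 _ (ltW t0)) (aM _))).
    rewrite /K exprMn !exprD !exprS le_eqVlt; apply/orP; left; apply/eqP.
    have E (x y p q u v : R) :
      x * (2 * p * q) * (y * u * v) = u * (2 * (x * p * y)) * (q * v) by ring.
    exact: E.
  apply: (le_trans (lerD IHm h1)); rewrite exprS.
  have q0 : 0 <= t ^+ n * (K * t) * (2 * t) ^+ m.
    have t2 : 0 <= 2 * t by lra.
    have Kt0 : 0 <= K * t by rewrite ltW// mulr_gt0.
    by rewrite mulr_ge0 ?exprn_ge0// mulr_ge0 ?exprn_ge0// ltW.
  rewrite -subr_ge0.
  have -> : t ^+ n * (4 * (K * t)) * (1 - 2 * t * (2 * t) ^+ m)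
    - (t ^+ n * (4 * (K * t)) * (1 - (2 * t) ^+ m)
       + t ^+ n * (2 * (K * t)) * (2 * t) ^+ m)
    = (t ^+ n * (K * t) * (2 * t) ^+ m) * (2 - 8 * t) by ring.
  by rewrite mulr_ge0//; lra.
have rb : normc (rest N) <= t ^+ n * (r / 2).
  apply: (le_trans (restb N)).
  apply: (@le_trans _ _ (t ^+ n * (4 * (K * t)))).
    rewrite ler_piMr ?mulr_ge0 ?exprn_ge0 ?ltW//.
    rewrite ltrBlDr ltrDl exprn_gt0//; lra.
  by rewrite ler_pM2l ?exprn_gt0//; lra.
have main : t ^+ n * r <=
    normc (series (fun k => a k * t%:C ^+ k) (n.+1 + N)%N) + normc (rest N).
  have -> : t ^+ n * r = normc (a n * t%:C ^+ n).
    by rewrite ComplexField.Normc.normcM ntX mulrC.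
  rewrite -[normc (rest N)]normcN.
  apply: le_trans (normcD_le _ _).
  by rewrite /rest opprB addrCA subrr addr0.
by move=> ?; lra.
Qed.

Lemma power_series_on_disc_uniq f a b :
  power_series_on_disc f a -> power_series_on_disc f b -> a = b.
Proof.
move=> fa fb; apply/funext => n; apply/eqP; rewrite -subr_eq0; apply/eqP.
rewrite -[_ - _]/((fun n => a n - b n) n); apply: power_series_on_disc_inj0.
have := power_series_on_discD fa (power_series_on_discZ (c := -1) fb).
rewrite (_ : (fun z => f z + -1 * f z) = fun=> 0); last first.
  by apply/funext => z; rewrite mulN1r subrr.
by rewrite (_ : (fun n => _) = fun n => a n - b n)//; apply/funext => m;
  rewrite mulN1r.
Qed.

Lemma taylor_coefE f a : power_series_on_disc f a -> taylor_coef f = a.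
Proof.
move=> fa; apply: power_series_on_disc_uniq (fa).
by rewrite /taylor_coef; case: xgetP => [b _|/(_ a)]//.
Qed.

End PowerSeries.

Section DirichletSpace.
Context {R : realType} (alpha : R).
Local Notation C := R[i].

Lemma dirichlet_predP (f : C -> C) :
  reflect (in_dirichlet alpha f /\ forall z, ~ unit_disc R z -> f z = 0)
          (f \in dirichlet_pred alpha).
Proof. exact: asboolP. Qed.

Lemma dirichlet_pred_submod : submod_closed (dirichlet_pred alpha).
Proof.
split => [|c f g /dirichlet_predP[[hf [a fa sa]] f0]
               /dirichlet_predP[[hg [b gb sb]] g0]].
  apply/dirichlet_predP; split; [split|].
  - by move=> z _; exact: (derivable_cst (0 : C)).
  - by exists (fun=> 0); [exact: power_series_on_disc0|exact: square_summable0].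
  - by move=> z _.
apply/dirichlet_predP; split; first split.
- move=> z zD; apply: derivableD; last exact: hg.
  by apply: derivableZ; exact: hf.
- exists (fun n => c * a n + b n).
    exact: power_series_on_discD (power_series_on_discZ (c := c) fa) gb.
  by apply: square_summableD => //; case: (square_summableZ c sa).
- move=> z zD; rewrite -[LHS]/(c * (f : C -> C) z + (g : C -> C) z).
  by rewrite f0// g0// mulr0 addr0.
Qed.

HB.instance Definition _ :=
  GRing.isSubmodClosed.Build C (C -> C) (dirichlet_pred alpha)
    dirichlet_pred_submod.

End DirichletSpace.

(* A holomorphic function on the disc is represented by its extension by zero
   to R[i], so that equality in [dirichlet] is equality on the disc. *)
Record dirichlet (R : realType) (alpha : R) := Dirichlet {
  dirichlet_fun :> R[i] -> R[i] ;
  dirichletP : dirichlet_fun \in dirichlet_pred alpha }.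

HB.instance Definition _ (R : realType) (alpha : R) :=
  [isSub for @dirichlet_fun R alpha].
HB.instance Definition _ (R : realType) (alpha : R) :=
  [Choice of dirichlet alpha by <:].
HB.instance Definition _ (R : realType) (alpha : R) :=
  [SubChoice_isSubLmodule of dirichlet alpha by <:].

Definition dirichlet_dot (R : realType) (alpha : R) (f g : dirichlet alpha)
    : R[i] :=
  limn (series (fun n => (dirichlet_weight alpha n)%:C
                         * taylor_coef f n * (taylor_coef g n)^* : R[i])).

Definition dirichlet_norm (R : realType) (alpha : R) (f : dirichlet alpha)
    : R[i] := sqrtC (dirichlet_dot f f).

Section DirichletNorm.
Context {R : realType} (alpha : R).
Local Notation C := R[i].
Implicit Types f g : dirichlet alpha.

Lemma taylor_coefP f : power_series_on_disc f (taylor_coef f) /\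
  square_summable alpha (taylor_coef f).
Proof.
have /dirichlet_predP := dirichletP f => -[[_ [a fa sa]] _].
by rewrite (taylor_coefE fa).
Qed.

Lemma taylor_coefD f g :
  taylor_coef (f + g) = (fun n => taylor_coef f n + taylor_coef g n).
Proof.
apply: taylor_coefE.
by apply: power_series_on_discD; [case: (taylor_coefP f)|case: (taylor_coefP g)].
Qed.

Lemma taylor_coefZ (c : C) f :
  taylor_coef (c *: f) = (fun n => c * taylor_coef f n).
Proof.
by apply: taylor_coefE; apply: power_series_on_discZ; case: (taylor_coefP f).
Qed.

Lemma dirichlet_dotE f :
  dirichlet_dot f f = (seq_sqnorm alpha (taylor_coef f))%:C.
Proof.
have [_ sf] := taylor_coefP f.
apply: cvg_lim => //.
rewrite (_ : series _ = fun n => (series (fun n => dirichlet_weight alpha n *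
  normc (taylor_coef f n) ^+ 2) n)%:C); first exact: cvgn_realC.
apply/funext => n; rewrite /series /= rmorph_sum; apply: eq_bigr => i _.
by rewrite -mulrA -sqr_normc normC_normc -rmorphXn -rmorphM.
Qed.

Lemma dirichlet_normE f :
  dirichlet_norm f = (Num.sqrt (seq_sqnorm alpha (taylor_coef f)))%:C.
Proof.
have [_ sf] := taylor_coefP f.
rewrite /dirichlet_norm dirichlet_dotE -[X in X%:C]sqr_sqrtr ?seq_sqnorm_ge0//.
by rewrite rmorphXn sqrCK// ler0c sqrtr_ge0.
Qed.

Lemma dirichlet_normD f g :
  dirichlet_norm (f + g) <= dirichlet_norm f + dirichlet_norm g.
Proof.
rewrite !dirichlet_normE -rmorphD lecR taylor_coefD.
by apply: seq_norm_triangle; [case: (taylor_coefP f)|case: (taylor_coefP g)].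
Qed.

Lemma dirichlet_normZ (c : C) f :
  dirichlet_norm (c *: f) = `|c| * dirichlet_norm f.
Proof.
rewrite !dirichlet_normE taylor_coefZ normC_normc -rmorphM; congr (_%:C).
have [_ ->] := square_summableZ c (taylor_coefP f).2.
by rewrite sqrtrM ?sqr_ge0// sqrtr_sqr ger0_norm// normc_ge0.
Qed.

Lemma dirichlet_norm0_eq0 f : dirichlet_norm f = 0 -> f = 0.
Proof.
have [fa sf] := taylor_coefP f.
rewrite dirichlet_normE => -[] /eqP; rewrite sqrtr_eq0 => h.
have f0 : seq_sqnorm alpha (taylor_coef f) = 0.
  by apply/eqP; rewrite eq_le h seq_sqnorm_ge0.
have c0 := seq_sqnorm_eq0 sf f0.
apply: val_inj; apply/funext => z /=.
have [zD|zD] := pselect (unit_disc R z); last first.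
  by have /dirichlet_predP := dirichletP f => -[_]; exact.
have := fa _ zD; rewrite (_ : series _ = fun=> 0); last first.
  by apply/funext => n; rewrite /series /= big1// => i _; rewrite c0 mul0r.
by move=> /cvg_lim <-//; rewrite lim_cst.
Qed.

HB.instance Definition _ := Lmodule_isNormed.Build C (dirichlet alpha)
  dirichlet_normD dirichlet_normZ dirichlet_norm0_eq0.

Lemma dirichlet_norm_normr f : `|f| = dirichlet_norm f.
Proof. by []. Qed.

End DirichletNorm.

Definition compact_operator (K : numFieldType) (V W : normedModType K)
    (T : {linear V -> W}) :=
  forall A : set V, bounded_set A -> precompact (T @` A).

Definition composition_differentiation (R : realType) (phi f : R[i] -> R[i])
    : R[i] -> R[i] := fun z => (f^`()%classic) (phi z).

Definition composition_differentiation_compact (R : realType) (alpha : R)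
    (phi : R[i] -> R[i]) :=
  exists2 T : {linear dirichlet alpha -> dirichlet alpha},
    forall (f : dirichlet alpha) z, unit_disc R z ->
      T f z = composition_differentiation phi f z
  & compact_operator T.

(* Main.v *)
(* Write T f = f' o phi as the sum over n of (n+1) a_(n+1) phi^n, where a is
   the sequence of Taylor coefficients of f.

   The matrix of multiplication by phi on coefficient sequences is lower
   triangular and, as |phi| <= r, has l^2 norm at most r; so the sum of the
   first N squared coefficients of phi g is at most r^2 times that of g, for
   every N. By Abel summation this extends to all nonincreasing weights, in
   particular to the weights (k+2)^(1-alpha) / (k+1)^2 that turn the Dirichlet
   norm of g into a norm on the coefficients of g'. Applied to
   (phi^n)' = n phi^(n-1) phi' it bounds the norm of phi^n by
   O((n+1) r^n), so (n+1) phi^n decays geometrically in the Dirichlet space.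

   Hence y |-> sum of (n+1) y_n phi^n makes sense for all bounded sequences y
   and is continuous for the product topology on bounded boxes. These boxes are
   compact by Tychonoff, and T maps a bounded set into the image of one of
   them; completeness of the Dirichlet space is not needed. *)

Require Import Defs.
From HB Require Import structures.
From mathcomp Require Import all_boot all_order all_algebra.
From mathcomp Require Import all_classical all_reals all_analysis.
From mathcomp Require Import complex.
From mathcomp Require Import ring lra.

Set Implicit Arguments.
Unset Strict Implicit.
Unset Printing Implicit Defensive.

Import Order.TTheory GRing.Theory Num.Theory.
Import numFieldNormedType.Exports.

Local Open Scope classical_set_scope.
Local Open Scope ring_scope.
Local Open Scope complex_scope.

(** * Modulus and convergence of complex sequences *)

Section ComplexModulus.
Context {R : realType}.
Local Notation C := R[i].
Implicit Types (u v : nat -> C) (x y z l : C).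

Lemma normcX z n : normc (z ^+ n) = normc z ^+ n.
Proof.
elim: n => [|n IH]; first by rewrite !expr0 ComplexField.Normc.normc1.
by rewrite !exprS ComplexField.Normc.normcM IH.
Qed.

Lemma normc_real (x : R) : 0 <= x -> normc x%:C = x.
Proof. by move=> x0; rewrite /normc /= expr0n /= addr0 sqrtr_sqr ger0_norm. Qed.

Lemma normc_nat n : normc (n%:R : C) = n%:R.
Proof. by rewrite -[n%:R in LHS](rmorph_nat (real_complex R)) normc_real. Qed.

Lemma normcB_sym x y : normc (x - y) = normc (y - x).
Proof. by rewrite -[RHS]normcN opprB. Qed.

Lemma normc_sum (I : Type) (s : seq I) (P : pred I) (F : I -> C) :
  normc (\sum_(i <- s | P i) F i) <= \sum_(i <- s | P i) normc (F i).
Proof.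
elim/big_ind2 : _ => //; first by rewrite ComplexField.Normc.normc0.
by move=> x a y b xa yb; apply: le_trans (normcD_le _ _) _; exact: lerD.
Qed.

Lemma cvgn_normcP u l :
  (forall e : R, 0 < e -> \forall n \near \oo, normc (u n - l) < e) ->
  u @ \oo --> l.
Proof.
move=> ul; apply/cvgrPdist_lt => e e0.
have eE : e = (complex.Re e)%:C by rewrite RRe_real// gtr0_real.
have e0' : 0 < complex.Re e by rewrite -ltcR -eE.
apply: filterS (ul _ e0') => n.
by rewrite eE normC_normc ltcR normcB_sym.
Qed.

Lemma cvgn_normc_le u l (e : R ^nat) :
  (forall n, normc (u n - l) <= e n) -> e @ \oo --> (0 : R) -> u @ \oo --> l.
Proof.
move=> ue /cvgrPdist_lt e0; apply: cvgn_normcP => d d0.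
apply: filterS (e0 _ d0) => n; rewrite sub0r normrN => end_.
by apply: le_lt_trans (ue n) _; apply: le_lt_trans end_; exact: ler_norm.
Qed.

Lemma normc_lim_le u l c (B : R) : u @ \oo --> l ->
  (\forall n \near \oo, normc (u n - c) <= B) -> normc (l - c) <= B.
Proof.
move=> /cvgn_normc ul uB; apply/ler_addgt0Pr => e e0.
near \oo => n.
have -> : l - c = (u n - c) + (l - u n) by ring.
apply: le_trans (normcD_le _ _) _; apply: lerD.
  by near: n.
by rewrite normcB_sym ltW//; near: n; exact: ul.
Unshelve. all: by end_near. Qed.

End ComplexModulus.

(** * Toeplitz contraction *)

Section Parseval.
Context {R : realType}.
Local Notation C := R[i].

(** [X^L - 1] splits over [C] and is separable in characteristic 0, so it has [L] distinct roots; a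
    full set of roots of unity contains a primitive one. *)
Lemma ex_prim_root L : (0 < L)%N -> exists w : C, L.-primitive_root w.
Proof.
move=> L0; have [s Es] := closed_field_poly_normal ('X^L - 1 : {poly C}).
rewrite (monicP _) ?monicXnsubC// scale1r in Es.
have sL : all L.-unity_root s by apply/allP => z; rewrite -root_prod_XsubC -Es.
have sz : (L <= size s)%N.
  by rewrite -ltnS -(size_prod_XsubC s id) -Es size_XnsubC.
have us : uniq s.
  rewrite -separable.separable_prod_XsubC -Es.
  by rewrite cyclotomic.separable_Xn_sub_1// pnatr_eq0 -lt0n.
by have /hasP[w _ ?] := cyclic.has_prim_root L0 sL us sz; exists w.
Qed.

Lemma prim_root_normc L (w : C) : L.-primitive_root w -> normc w = 1.
Proof.
move=> wL; have := congr1 (@normc R) (prim_expr_order wL).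
rewrite normcX ComplexField.Normc.normc1 => /eqP.
by rewrite pexprn_eq1 ?normc_ge0// eqn0Ngt (prim_order_gt0 wL) => /eqP.
Qed.

Lemma prim_root_neq0 L (w : C) : L.-primitive_root w -> w != 0.
Proof.
move=> /prim_root_normc; apply: contra_eq_neq => ->.
by rewrite ComplexField.Normc.normc0 eq_sym oner_eq0.
Qed.

(** The ratio of the two powers is an [L]-th root of unity, so its geometric sum vanishes unless it
    is 1, which for exponents below [L] forces [n = m]. *)
Lemma sum_prim_root L (w : C) n m : L.-primitive_root w -> (n < L)%N ->
  (m < L)%N ->
  \sum_(j < L) (w ^+ n * (w ^+ m)^-1) ^+ j = (if n == m then L%:R else 0).
Proof.
move=> wL nL mL; set z := _ * _.
have w0 : w ^+ m != 0.
  by rewrite expf_neq0// (prim_root_neq0 wL).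
case: eqP => [E|/eqP E].
  rewrite (eq_bigr (fun=> 1)) => [|i _]; first by rewrite sumr_const card_ord.
  by rewrite /z E divff// expr1n.
have z1 : z != 1.
  apply: contra E => /eqP zE; have : w ^+ n = w ^+ m by rewrite -[LHS](divfK w0) -/z zE mul1r.
  by move/eqP; rewrite (eq_prim_root_expr wL) /eqn !modn_small.
have zL : z ^+ L = 1.
  rewrite exprMn exprVn -!exprM ![(_ * L)%N]mulnC !exprM.
  by rewrite !(prim_expr_order wL) !expr1n invr1 mulr1.
have := subrX1 z L; rewrite zL subrr => /esym/eqP.
by rewrite mulf_eq0 subr_eq0 (negPf z1) => /eqP.
Qed.

(** Expand the squared moduli and sum over [j] first: orthogonality leaves only the diagonal terms,
    each counted [L] times. *)
Lemma prim_root_parseval L (w : C) (u : nat -> C) : L.-primitive_root w ->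
  \sum_(j < L) normc (\sum_(n < L) u n * (w ^+ j) ^+ n) ^+ 2
  = L%:R * \sum_(n < L) normc (u n) ^+ 2.
Proof.
have sqE (z : C) : ((normc z ^+ 2)%:C : C) = z * (z)^*%R.
  by rewrite -normCK normC_normc rmorphXn.
move=> wL; apply: complexI; rewrite rmorphM rmorph_nat !rmorph_sum /=.
under eq_bigr do rewrite sqE rmorph_sum /= mulr_suml.
under [in RHS]eq_bigr do rewrite sqE.
rewrite exchange_big mulr_sumr; apply: eq_bigr => n _ /=.
under eq_bigr do rewrite mulr_sumr.
rewrite exchange_big (bigD1 n)//= [X in _ + X]big1 ?addr0 => [|m mn].
- under eq_bigr => j _.
    rewrite -sqE ComplexField.Normc.normcM !normcX (prim_root_normc wL).
    rewrite !expr1n mulr1 sqE. over.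
  by rewrite sumr_const card_ord mulr_natl.
- have wE : (w)^*%R = w^-1.
    have := normCK w; rewrite normC_normc (prim_root_normc wL) expr1n => h.
    have w0 := prim_root_neq0 wL.
    by apply: (mulfI w0); rewrite -h divff.
  have wjE j : (w ^+ j) ^+ n * (w^-1 ^+ j) ^+ m = (w ^+ n * (w ^+ m)^-1) ^+ j.
    by rewrite exprMn -exprVn -!exprM ![(j * _)%N]mulnC.
  under eq_bigr do rewrite rmorphM mulrACA !rmorphXn /= wE wjE.
  by rewrite -mulr_sumr sum_prim_root// eq_sym (inj_eq val_inj) (negPf mn) mulr0.
Qed.

End Parseval.

(** * Geometric estimates for series *)

Section Geometric.
Context {R : realType}.
Local Notation C := R[i].
Implicit Types (u a : nat -> C) (l : C) (q s K : R).

Lemma sum_geometric_le q m n : 0 <= q < 1 ->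
  \sum_(m <= k < n) q ^+ k <= q ^+ m / (1 - q).
Proof.
move=> /andP[q0 q1]; have q10 : 0 < 1 - q by rewrite subr_gt0.
rewrite ler_pdivlMr//; have [nm|mn] := leqP n m.
  by rewrite big_geq// mul0r exprn_ge0.
rewrite mulr_suml (eq_bigr (fun k => - (q ^+ k.+1 - q ^+ k))) => [|k _].
  by rewrite sumrN telescope_sumr ?(ltnW mn)// opprB gerBl exprn_ge0.
by rewrite exprS; ring.
Qed.

(** The quotient of [s ^+ n.+1 - q ^+ n.+1] by [s - q] is a sum of [n.+1] products, each at least
    [q ^+ n]. A linear factor is thus traded for a larger ratio. *)
Lemma natr_geometric_le q s n : 0 <= q < s ->
  n.+1%:R * q ^+ n <= s / (s - q) * s ^+ n.
Proof.
move=> /andP[q0 qs]; have sq : 0 < s - q by rewrite subr_gt0.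
rewrite mulrAC ler_pdivlMr//.
apply: (@le_trans _ _ (s ^+ n.+1 - q ^+ n.+1)); last first.
  by rewrite exprS gerBl exprn_ge0.
rewrite subrXX [leRHS]mulrC ler_pM2r//.
apply: (@le_trans _ _ (\sum_(i < n.+1) q ^+ n)).
  by rewrite sumr_const card_ord mulr_natl.
apply: ler_sum => i _; rewrite /= -{1}(subnK (leq_ord i)) exprD.
rewrite ler_wpM2r ?exprn_ge0// lerXn2r ?nnegrE ?(ltW qs)//.
exact: ltW (le_lt_trans q0 qs).
Qed.

Lemma cvg_series_bounded u l : series u @ \oo --> l ->
  exists2 K, 0 <= K & forall n, normc (u n) <= K.
Proof.
move=> ul; have cu : cvgn (series u) by apply/cvg_ex; exists l.
have := cvgn_normc (cvg_series_cvg_0 cu) ltr01; rewrite nearE => -[N _ HN].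
have S0 : 0 <= \sum_(i < N) normc (u i) by apply: sumr_ge0 => i _; exact: normc_ge0.
exists (1 + \sum_(i < N) normc (u i)); first lra.
move=> n; have [Nn|nN] := leqP N n.
  have := HN n Nn; rewrite /= subr0; lra.
rewrite (bigD1 (Ordinal nN))//= addrCA lerDl addr_ge0// sumr_ge0// => i _.
exact: normc_ge0.
Qed.

(** At a point [t] strictly between [x] and 1 the terms of the convergent series are bounded, which
    gives the ratio [q = x / t]. *)
Lemma power_series_geometric (f : C -> C) a (x : R) :
  power_series_on_disc f a -> 0 <= x < 1 ->
  exists K q, [/\ 0 <= K, 0 <= q < 1 &
    forall n, normc (a n) * x ^+ n <= K * q ^+ n].
Proof.
move=> fa /andP[x0 x1]; pose t := (1 + x) / 2.
have t0 : 0 < t by rewrite /t; lra.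
have tD : unit_disc R t%:C by rewrite disc_normc normc_real ?ltW// /t; lra.
have [K K0 aK] := cvg_series_bounded (fa _ tD).
exists K, (x / t); split=> //.
  apply/andP; split; first exact: divr_ge0 x0 (ltW t0).
  by rewrite ltr_pdivrMr// /t; lra.
move=> n; rewrite expr_div_n mulrCA mulrC ler_wpM2l ?exprn_ge0//.
rewrite ler_pdivlMr ?exprn_gt0//; apply: le_trans (aK n).
by rewrite ComplexField.Normc.normcM normcX normc_real// ltW.
Qed.

Lemma series_tail_le u l K q m : 0 <= K -> 0 <= q < 1 ->
  (forall n, normc (u n) <= K * q ^+ n) -> series u @ \oo --> l ->
  normc (l - series u m) <= K * (q ^+ m / (1 - q)).
Proof.
move=> K0 q01 uK ul; apply: (normc_lim_le ul); near=> n.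
have mn : (m <= n)%N by near: n; exact: nbhs_infty_ge.
rewrite sub_series_geq//; apply: le_trans (normc_sum _ _ _) _.
apply: (@le_trans _ _ (\sum_(m <= k < n) K * q ^+ k)); first exact: ler_sum.
by rewrite -mulr_sumr ler_wpM2l// sum_geometric_le.
Unshelve. all: by end_near. Qed.

Lemma Re_normc_le (z : C) : `|complex.Re z| <= normc z.
Proof.
case: z => x y; rewrite /normc /= -sqrtr_sqr ler_wsqrtr//.
by rewrite lerDl sqr_ge0.
Qed.

Lemma Im_normc_le (z : C) : `|complex.Im z| <= normc z.
Proof.
case: z => x y; rewrite /normc /= -sqrtr_sqr ler_wsqrtr//.
by rewrite lerDr sqr_ge0.
Qed.

(** Real and imaginary parts are treated separately, each dominated by a real geometric series. *)
Lemma cvg_series_geometric u K q : 0 <= q < 1 ->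
  (forall n, normc (u n) <= K * q ^+ n) -> cvgn (series u).
Proof.
move=> /andP[q0 q1] uK.
have H (v : R ^nat) : (forall n, `|v n| <= normc (u n)) -> cvgn (series v).
  move=> vu; apply: normed_cvg; apply: (@series_le_cvg _ _ (geometric K q)) => //.
  - by move=> n; apply: normr_ge0.
  - by move=> n; apply: le_trans (uK n); exact: normc_ge0.
  - by move=> n; apply: le_trans (vu n) (uK n).
  - by apply: is_cvg_geometric_series; rewrite ger0_norm.
have /cvg_ex[x vx] := H _ (fun n => Re_normc_le (u n)).
have /cvg_ex[y vy] := H _ (fun n => Im_normc_le (u n)).
apply/cvg_ex; exists (x%:C + y%:C * 'i%C : C).
rewrite (_ : series u = (fun n => (series (fun n => complex.Re (u n)) n)%:C
   + (series (fun n => complex.Im (u n)) n)%:C * 'i%C)); last first.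
  apply/funext => n; rewrite /series /= !rmorph_sum mulr_suml -big_split /=.
  by apply: eq_bigr => i _; rewrite [LHS]complexE mulrC.
apply: cvgD; first exact: cvgn_realC.
by apply: cvgMl; exact: cvgn_realC.
Qed.

End Geometric.

(** * Cauchy products as contractions on coefficients *)

Section Contraction.
Context {R : realType}.
Local Notation C := R[i].
Implicit Types (a : nat -> C) (u : nat -> C) (g : C -> C) (f : {poly C}).

Lemma horner_truncation a z N :
  (\poly_(i < N) a i).[z] = series (fun n => a n * z ^+ n) N.
Proof. by rewrite horner_poly /series /= big_mkord. Qed.

(** The lower triangular Toeplitz matrix of [a] applied to [u]: on Taylor coefficients,
    multiplication by the function with coefficients [a]. *)
Definition cauchy_product a u : nat -> C :=
  fun k => \sum_(i < k.+1) a i * u (k - i)%N.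

(** Coefficient [k] of a product depends only on coefficients of index at most [k]. Polynomial
    algebra can therefore stand in for power series. *)
Lemma coef_mul_truncation a u f N k : (k < N)%N ->
  (forall i, (i <= k)%N -> f`_i = u i) ->
  ((\poly_(i < N) a i) * f)`_k = cauchy_product a u k.
Proof.
move=> kN fu; rewrite coefM; apply: eq_bigr => i _.
by rewrite coef_poly (leq_ltn_trans (leq_ord i) kN) fu// leq_subr.
Qed.

Lemma coef_expr_truncation a u f N n k : (k < N)%N ->
  (forall i, (i <= k)%N -> f`_i = u i) ->
  ((\poly_(i < N) a i) ^+ n * f)`_k = iter n (cauchy_product a) u k.
Proof.
elim: n k => [|n IH] k kN fu; first by rewrite expr0 mul1r fu.
rewrite exprS -mulrA; apply: coef_mul_truncation => // i ik.
by apply: IH => [|j ji]; [exact: leq_ltn_trans kN | apply: fu; exact: leq_trans ik].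
Qed.

Lemma ler_sum_widen (F : R ^nat) N M : (N <= M)%N -> (forall i, 0 <= F i) ->
  \sum_(i < N) F i <= \sum_(i < M) F i.
Proof.
move=> NM F0; rewrite (big_ord_widen _ F NM) big_mkcond /=.
by apply: ler_sum => i _; case: ifP.
Qed.

(* Sampling at roots of unity on the circle of radius [1 - t], where [g] is
   uniformly close to a Taylor polynomial, and letting [t] tend to 0. *)
Lemma cauchy_product_contraction g a (r : R) u N :
  power_series_on_disc g a ->
  (forall z, unit_disc R z -> normc (g z) <= r) ->
  \sum_(k < N) normc (cauchy_product a u k) ^+ 2
    <= r ^+ 2 * \sum_(k < N) normc (u k) ^+ 2.
Proof.
move=> ga gr; set X := \sum_(k < N) normc (cauchy_product a u k) ^+ 2.
set Y := \sum_(k < N) normc (u k) ^+ 2.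
have X0 : 0 <= X by apply: sumr_ge0 => i _; exact: sqr_ge0.
have Y0 : 0 <= Y by apply: sumr_ge0 => i _; exact: sqr_ge0.
have r0 : 0 <= r.
  apply: le_trans (normc_ge0 (g 0)) (gr _ _).
  by rewrite disc_normc ComplexField.Normc.normc0 ltr01.
(* Sampling at radius [1 - t] scales coefficient [n] by [(1 - t) ^+ n], which for [n < N] is at
   least [(1 - t) ^+ N]. *)
have key t : 0 < t < 1 -> (1 - t) ^+ N ^+ 2 * X <= (r + t) ^+ 2 * Y.
  move=> /andP[t0 t1]; set x := 1 - t.
  have x0 : 0 < x by rewrite /x; lra.
  have x1 : x < 1 by rewrite /x; lra.
  (* The tail bound depends on [z] only through its modulus, so one [M] serves the whole circle. *)
  have [M [NM gM]] : exists M, (N <= M)%N /\ forall z, normc z = x ->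
      normc ((\poly_(i < M) a i).[z]) <= r + t.
    have x01 : 0 <= x < 1 by rewrite ltW.
    have [K [q [K0 /andP[q0 q1] aK]]] := power_series_geometric ga x01.
    have : (fun n => K / (1 - q) * q ^+ n) @ \oo --> (0 : R).
      by apply: (@cvg_geometric _ (K / (1 - q)) q); rewrite ger0_norm.
    move=> /cvgrPdist_lt/(_ _ t0)[M _ /(_ (N + M)%N (leq_addl _ _))] /=.
    rewrite sub0r normrN ger0_norm; last first.
      by rewrite !mulr_ge0 ?exprn_ge0// invr_ge0 subr_ge0 ltW.
    move=> tail; exists (N + M)%N; split=> [|z zx]; first exact: leq_addr.
    have zD : unit_disc R z by rewrite disc_normc zx.
    have zK n : normc (a n * z ^+ n) <= K * q ^+ n.
      by rewrite ComplexField.Normc.normcM normcX zx.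
    have q01 : 0 <= q < 1 by rewrite q0.
    have := series_tail_le (N + M) K0 q01 zK (ga _ zD).
    rewrite normcB_sym mulrCA mulrC -horner_truncation => le1.
    rewrite -[_.[z]](subrK (g z)) addrC; apply: le_trans (normcD_le _ _) _.
    apply: lerD; first exact: gr.
    apply: le_trans le1 _; apply: le_trans (ltW tail).
    by rewrite mulrAC.
  pose f0 := \poly_(i < N) u i; pose p := (\poly_(i < M) a i) * f0.
  pose L := (M + N).+1.
  have sz0 : (size f0 <= L)%N.
    by apply: leq_trans (size_poly _ _) _; rewrite leqW// leq_addl.
  have szp : (size p <= L)%N.
    apply: leq_trans (size_polyMleq _ _) _; apply: leq_trans (leq_pred _) _.
    by rewrite leqW// leq_add// size_poly.
  have [w wL] := @ex_prim_root R L isT.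
  have sample (h : {poly C}) j : (size h <= L)%N ->
      h.[x%:C * w ^+ j] = \sum_(n < L) (h`_n * x%:C ^+ n) * (w ^+ j) ^+ n.
    move=> hL; rewrite (horner_coef_wide _ hL); apply: eq_bigr => n _.
    by rewrite exprMn mulrA.
  have sum_le : \sum_(n < L) normc (p`_n * x%:C ^+ n) ^+ 2 <=
      (r + t) ^+ 2 * \sum_(n < L) normc (f0`_n * x%:C ^+ n) ^+ 2.
    have L0 : 0 < L%:R :> R by rewrite ltr0n.
    rewrite -(ler_pM2l L0) mulrCA.
    rewrite -(prim_root_parseval (fun n => p`_n * x%:C ^+ n) wL).
    rewrite -(prim_root_parseval (fun n => f0`_n * x%:C ^+ n) wL) mulr_sumr.
    apply: ler_sum => j _; rewrite -!sample// hornerM ComplexField.Normc.normcM.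
    rewrite -exprMn lerXn2r ?nnegrE ?mulr_ge0 ?normc_ge0//; first by lra.
    rewrite ler_wpM2r ?normc_ge0// gM//.
    rewrite ComplexField.Normc.normcM normcX (prim_root_normc wL) expr1n mulr1.
    by rewrite normc_real// ltW.
  have NL : (N <= L)%N by rewrite leqW// leq_addl.
  have termE (h : {poly C}) n : normc (h`_n * x%:C ^+ n) ^+ 2 =
      normc h`_n ^+ 2 * x ^+ n ^+ 2.
    by rewrite ComplexField.Normc.normcM normcX normc_real ?exprMn// ltW.
  (* Only the first [N] coefficients of [p] are kept; since [N <= M] they are those of the Cauchy
     product. *)
  apply: (@le_trans _ _ (\sum_(n < L) normc (p`_n * x%:C ^+ n) ^+ 2)).
    pose F n := normc (p`_n * x%:C ^+ n) ^+ 2.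
    have F0 i : 0 <= F i by exact: sqr_ge0.
    apply: le_trans (ler_sum_widen NL F0); rewrite /F {F F0}.
    rewrite mulr_sumr; apply: ler_sum => n _; rewrite termE mulrC.
    have -> : p`_n = cauchy_product a u n.
      apply: coef_mul_truncation => [|i ni]; first exact: leq_trans NM.
      by rewrite coef_poly (leq_ltn_trans ni).
    rewrite ler_wpM2l ?sqr_ge0// lerXn2r ?nnegrE ?exprn_ge0// ?(ltW x0)//.
    by apply: ler_wiXn2l (ltW x0) (ltW x1) _ _ (ltnW (ltn_ord n)).
  apply: le_trans sum_le _; rewrite ler_wpM2l ?sqr_ge0//.
  rewrite /Y (big_ord_widen _ (fun n => normc (u n) ^+ 2) NL) [leRHS]big_mkcond.
  apply: ler_sum => n _; rewrite termE coef_poly; case: ifP => _.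
    rewrite ler_piMr ?sqr_ge0// -exprM exprn_ile1// ltW//.
  by rewrite ComplexField.Normc.normc0 expr0n mul0r.
(* [D] collects the first-order terms in [t]: [N%:R * 2 * X] from Bernoulli's inequality on the
   left, the rest from [(r + t) ^+ 2] with [t ^+ 2 <= t]. *)
apply/ler_addgt0Pr => e e0; pose D := N%:R * 2 * X + 2 * r * Y + Y.
have D0 : 0 <= D by rewrite !addr_ge0 ?mulr_ge0.
pose t := Num.min (2^-1) (e / (D + 1)).
have t0 : 0 < t by rewrite lt_min invr_gt0 ltr0n divr_gt0//; lra.
have t2 : t <= 2^-1 by rewrite ge_min lexx.
have tD : t * D <= e.
  apply: (@le_trans _ _ (t * (D + 1))); first by rewrite ler_pM2l//; lra.
  rewrite -ler_pdivlMr; last lra.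
  by rewrite ge_min lexx orbT.
have t01 : 0 < t < 1 by rewrite t0; lra.
have := key _ t01; clearbody t.
have : (1 - (N * 2)%:R * t) * X <= (1 - t) ^+ N ^+ 2 * X.
  rewrite ler_wpM2r// -exprM.
  elim: (N * 2)%N => [|n IH]; first by rewrite mul0r subr0 expr0.
  have t1 : 0 <= 1 - t by lra.
  rewrite exprSr; apply: le_trans (ler_wpM2r t1 IH).
  rewrite -natr1 -subr_ge0.
  rewrite (_ : _ - _ = n%:R * t ^+ 2); first by rewrite mulr_ge0 ?sqr_ge0.
  by ring.
rewrite natrM => h1 h2; have := le_trans h1 h2.
have : t * t * Y <= t * Y by rewrite ler_wpM2r// ler_piMl//; lra.
move: tD; rewrite /D; lra.
Qed.

(* The sum stays above [v n] times the [n.+1]-st partial sum of [z]. *)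
Lemma abel_sum_ge0 (v z : R ^nat) n : nonincreasing_seq v ->
  (forall k, 0 <= v k) -> (forall k, 0 <= \sum_(i < k) z i) ->
  0 <= \sum_(i < n) v i * z i.
Proof.
move=> vd v0 z0; case: n => [|n]; first by rewrite big_ord0.
apply: (@le_trans _ _ (v n * \sum_(i < n.+1) z i)); first exact: mulr_ge0.
elim: n => [|n IH]; first by rewrite !big_ord1.
rewrite [X in _ * X]big_ord_recr [leRHS]big_ord_recr /= mulrDr lerD2r.
apply: le_trans IH; rewrite ler_wpM2r ?z0 ?vd//.
Qed.

(** Apply the preceding positivity to [y - x]. Unweighted bounds on all partial sums carry over to
    nonincreasing weights in this way. *)
Lemma abel_ler_sum (v x y : R ^nat) n : nonincreasing_seq v ->
  (forall k, 0 <= v k) ->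
  (forall k, \sum_(i < k) x i <= \sum_(i < k) y i) ->
  \sum_(i < n) v i * x i <= \sum_(i < n) v i * y i.
Proof.
move=> vd v0 xy; rewrite -subr_ge0 -sumrB.
under eq_bigr do rewrite -mulrBr.
apply: (abel_sum_ge0 (z := fun i => y i - x i)) => // k.
by rewrite sumrB subr_ge0.
Qed.

Lemma iter_cauchy_product_contraction g a (r : R) u n N :
  power_series_on_disc g a ->
  (forall z, unit_disc R z -> normc (g z) <= r) ->
  \sum_(k < N) normc (iter n (cauchy_product a) u k) ^+ 2
    <= r ^+ n ^+ 2 * \sum_(k < N) normc (u k) ^+ 2.
Proof.
move=> ga gr; elim: n => [|n IH]; first by rewrite expr0 expr1n mul1r.
rewrite [r ^+ n.+1]exprS; apply: le_trans (cauchy_product_contraction _ _ ga gr) _.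
by rewrite exprMn -[leRHS]mulrA ler_wpM2l ?sqr_ge0.
Qed.

(** The starting sequence is that of the constant 1, so these are the Taylor coefficients of the
    [n]-th power. *)
Definition power_coef a n : nat -> C :=
  iter n (cauchy_product a) (fun k => (k == 0%N)%:R).

Lemma coef_truncation_expr a N n k : (k < N)%N ->
  ((\poly_(i < N) a i) ^+ n)`_k = power_coef a n k.
Proof.
move=> kN; rewrite -[_ ^+ n]mulr1; apply: coef_expr_truncation => // i _.
by rewrite coef1.
Qed.

(* Coefficientwise form of [(phi ^+ n)' = n * phi ^+ n.-1 * phi']. *)
Lemma power_coef_deriv a n k :
  k.+1%:R * power_coef a n k.+1 =
  n%:R * iter n.-1 (cauchy_product a) (fun j => j.+1%:R * a j.+1) k.
Proof.
rewrite -(coef_truncation_expr a n (ltnSn k.+1)) mulr_natl -coef_deriv.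
rewrite deriv_exp coefMn mulr_natl mulrC; congr (_ *+ _).
apply: coef_expr_truncation => // i ik.
by rewrite coef_deriv coef_poly !ltnS ik mulr_natl.
Qed.

End Contraction.

(** * Norms of powers *)

Section PowerNorm.
Context {R : realType} (alpha : R).
Local Notation C := R[i].
Hypothesis alpha01 : 0 < alpha < 1.

Lemma dirichlet_weight_ge1 n : 1 <= dirichlet_weight alpha n.
Proof.
have p0 : 0 <= 1 - alpha by have /andP[_ ?] := alpha01; lra.
by rewrite /dirichlet_weight -[leLHS](powRr0 n.+1%:R) ler_powR// ler1n.
Qed.

(** Since (k+2)/(k+1)^2 = 1/(k+1) + 1/(k+1)^2, the weight is this sum times (k+2)^(-alpha), and both
    factors are nonincreasing. *)
Lemma dirichlet_weight_deriv_noninc :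
  nonincreasing_seq (fun k => dirichlet_weight alpha k.+1 / k.+1%:R ^+ 2).
Proof.
have wE k : dirichlet_weight alpha k.+1 / k.+1%:R ^+ 2 =
    (k.+2%:R `^ alpha)^-1 * (k.+1%:R^-1 + k.+1%:R^-1 ^+ 2).
  rewrite /dirichlet_weight powRD ?powRN ?powRr1//; last by rewrite pnatr_eq0 implybT.
  have : k.+2%:R `^ alpha != 0 by rewrite gt_eqF// powR_gt0.
  set x := _ `^ alpha => x0; rewrite -[k.+2%:R]natr1.
  by field; rewrite x0 nat1r pnatr_eq0.
have alpha0 : 0 <= alpha by have /andP[/ltW] := alpha01.
have inv_le k l : (k <= l)%N -> (l.+1%:R^-1 : R) <= k.+1%:R^-1.
  by move=> kl; rewrite lef_pV2 ?posrE// ler_nat ltnS.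
move=> k l kl; rewrite !wE; apply: ler_pM => //.
- rewrite lef_pV2 ?posrE ?powR_gt0// ge0_ler_powR ?nnegrE//.
  by rewrite ler_nat !ltnS.
- by rewrite lerD ?inv_le// lerXn2r ?nnegrE ?inv_le.
Qed.

(** The constant coefficient gives [r ^+ n ^+ 2]. The others are read off the derivative of the
    [n]-th power: the contraction bounds its unweighted partial sums, and Abel summation brings in
    the weights. *)
Lemma power_coef_sqnorm g (a : nat -> C) (r : R) n :
  power_series_on_disc g a -> square_summable alpha a ->
  (forall z, unit_disc R z -> normc (g z) <= r) ->
  square_summable alpha (power_coef a n) /\
  seq_sqnorm alpha (power_coef a n) <=
    r ^+ n ^+ 2 + (n%:R * r ^+ n.-1) ^+ 2 * seq_sqnorm alpha a.
Proof.
move=> ga sa gr; apply: seq_sqnorm_bound => -[|N].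
  by rewrite /series /= big_geq// addr_ge0 ?sqr_ge0// mulr_ge0 ?sqr_ge0 ?seq_sqnorm_ge0.
rewrite /series [leLHS]big_mkord big_ord_recl; apply: lerD.
  (* Index 0 has weight 1; the contraction is used on a single coefficient. *)
  rewrite /dirichlet_weight powR1 mul1r.
  have := iter_cauchy_product_contraction (fun k => (k == 0%N)%:R) n 1 ga gr.
  by rewrite !big_ord1 eqxx normc_nat expr1n mulr1.
(* [d] holds the coefficients of the derivative of [g]; [v] compensates the squared factor that
   differentiation introduces. *)
pose d j : C := j.+1%:R * a j.+1.
pose v k : R := dirichlet_weight alpha k.+1 / k.+1%:R ^+ 2.
have v0 k : 0 <= v k.
  by rewrite divr_ge0 ?sqr_ge0// ltW// dirichlet_weight_gt0.
have vE (b c : C) k : k.+1%:R * b = c ->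
    dirichlet_weight alpha k.+1 * normc b ^+ 2 = v k * normc c ^+ 2.
  by move=> <-; rewrite ComplexField.Normc.normcM normc_nat exprMn [RHS]mulrA /v divfK//.
under eq_bigr => k _ do rewrite lift0 (vE _ _ _ (power_coef_deriv a n k))
  ComplexField.Normc.normcM normc_nat exprMn.
apply: (@le_trans _ _ (\sum_(k < N) v k *
    ((n%:R * r ^+ n.-1) ^+ 2 * normc (d k) ^+ 2))).
  apply: (@abel_ler_sum _ v (fun k => n%:R ^+ 2 *
    normc (iter n.-1 (cauchy_product a) d k) ^+ 2)
    (fun k => (n%:R * r ^+ n.-1) ^+ 2 * normc (d k) ^+ 2)) => //.
    exact: dirichlet_weight_deriv_noninc.
  move=> k; rewrite -!mulr_sumr exprMn -[leRHS]mulrA ler_wpM2l ?sqr_ge0//.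
  exact: iter_cauchy_product_contraction ga gr.
rewrite (eq_bigr (fun k : 'I_N => (n%:R * r ^+ n.-1) ^+ 2 *
    (dirichlet_weight alpha k.+1 * normc (a k.+1) ^+ 2))) => [|k _]; last first.
  by rewrite mulrCA (vE _ (d k)).
rewrite -mulr_sumr ler_wpM2l ?sqr_ge0//.
apply: le_trans (seq_sqnorm_partial N.+1 sa).
rewrite /series /= big_mkord big_ord_recl lerDr.
by rewrite mulr_ge0 ?sqr_ge0// ltW// dirichlet_weight_gt0.
Qed.

End PowerNorm.

(** * Products and derivatives of power series *)

Section PowerSeriesCalculus.
Context {R : realType}.
Local Notation C := R[i].
Implicit Types (a b u : nat -> C) (f g : C -> C) (z : C) (q : R).

(** Two applications of [natr_geometric_le], with ratios [q < s < s' < 1], absorb one linear factor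
    each. *)
Lemma natr2_geometric_le q : 0 <= q < 1 ->
  exists K s, [/\ 0 <= K, 0 <= s < 1 &
    forall n, n.+1%:R ^+ 2 * q ^+ n <= K * s ^+ n].
Proof.
move=> /andP[q0 q1]; pose s := (1 + q) / 2; pose s' := (1 + s) / 2.
have qs : 0 <= q < s by rewrite q0 /s; lra.
have ss : 0 <= s < s' by apply/andP; split; rewrite /s' /s; lra.
have K0 (x y : R) : 0 <= x < y -> 0 <= y / (y - x).
  move=> /andP[x0 xy]; rewrite divr_ge0 ?subr_ge0 ?(ltW xy)//.
  exact: ltW (le_lt_trans x0 xy).
exists (s / (s - q) * (s' / (s' - s))), s'; split.
- by rewrite mulr_ge0 ?K0.
- by apply/andP; split; rewrite /s' /s; lra.
move=> n; rewrite expr2 -mulrA.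
apply: le_trans (ler_wpM2l (ler0n _ _) (natr_geometric_le n qs)) _.
by rewrite mulrCA -[leRHS]mulrA ler_wpM2l ?K0// natr_geometric_le.
Qed.

Lemma cvg_natr_geometric K q : 0 <= q < 1 ->
  (fun n => K * (n.+1%:R * q ^+ n)) @ \oo --> (0 : R).
Proof.
move=> /andP[q0 q1]; pose s := (1 + q) / 2.
have qs : 0 <= q < s by rewrite q0 /s; lra.
rewrite -[0](mulr0 K); apply: cvgMr.
apply: (@squeeze_cvgr _ _ _ _ (fun=> 0) (fun n => s / (s - q) * s ^+ n)).
- near=> n; rewrite natr_geometric_le// andbT.
  by rewrite mulr_ge0 ?exprn_ge0.
- exact: cvg_cst.
- by apply: (@cvg_geometric _ (s / (s - q)) s); rewrite ger0_norm /s; lra.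
Unshelve. all: by end_near. Qed.

(** The terms with i + j < N are summed row by row, each row being a partial sum of the second
    series. *)
Lemma series_cauchy_product a b z N :
  series (fun n => cauchy_product a b n * z ^+ n) N =
  \sum_(i < N) a i * z ^+ i * series (fun n => b n * z ^+ n) (N - i)%N.
Proof.
elim: N => [|N IH]; first by rewrite big_ord0 /series /= big_geq.
rewrite seriesSr IH [RHS]big_ord_recr subSnn /=.
rewrite [cauchy_product a b N]big_ord_recr mulrDl addrA subnn; congr (_ + _).
  rewrite mulr_suml -big_split; apply: eq_bigr => i _ /=.
  rewrite subSn ?(ltnW (ltn_ord i))// seriesSr mulrDr; congr (_ + _).
  have -> : z ^+ N = z ^+ i * z ^+ (N - i).
    by rewrite -exprD subnKC// ltnW.
  by ring.
by rewrite /series /= big_nat1 expr0; ring.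
Qed.

(** In the row-wise form the error consists of [N] products of a term of one series with a tail of
    the other, plus a last tail. Each is of order [q ^+ N], and (N+1) q^N tends to 0. *)
Lemma power_series_on_discM f g a b :
  power_series_on_disc f a -> power_series_on_disc g b ->
  power_series_on_disc (fun z => f z * g z) (cauchy_product a b).
Proof.
move=> fa gb z zD; have zn := zD; rewrite disc_normc in zn.
have z01 : 0 <= normc z < 1 by rewrite normc_ge0.
have [K [q1 [K0 q101 aK1]]] := power_series_geometric fa z01.
have [L [q2 [L0 q201 bL2]]] := power_series_geometric gb z01.
pose q := Num.max q1 q2.
have q01 : 0 <= q < 1.
  by rewrite le_max gt_max; move: q101 q201 => /andP[-> ->] /andP[].
have /andP[q0 q1'] := q01.
have q10 : 0 < 1 - q by rewrite subr_gt0.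
have qX (p : R) n : 0 <= p -> p <= q -> p ^+ n <= q ^+ n.
  by move=> p0 pq; rewrite lerXn2r ?nnegrE.
have aK n : normc (a n * z ^+ n) <= K * q ^+ n.
  rewrite ComplexField.Normc.normcM normcX (le_trans (aK1 n))// ler_wpM2l//.
  by case/andP: q101 => q10' _; apply: qX; rewrite ?le_max ?lexx.
have bL n : normc (b n * z ^+ n) <= L * q ^+ n.
  rewrite ComplexField.Normc.normcM normcX (le_trans (bL2 n))// ler_wpM2l//.
  by case/andP: q201 => q20' _; apply: qX; rewrite ?le_max ?lexx ?orbT.
pose M := K * L / (1 - q) + K / (1 - q) * normc (g z).
apply: (@cvgn_normc_le _ _ _ (fun N => M * (N.+1%:R * q ^+ N))); last first.
  exact: (cvg_natr_geometric M q01).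
move=> N; rewrite series_cauchy_product normcB_sym.
have -> : f z * g z -
    \sum_(i < N) a i * z ^+ i * series (fun n => b n * z ^+ n) (N - i)%N =
    \sum_(i < N) a i * z ^+ i * (g z - series (fun n => b n * z ^+ n) (N - i)%N)
    + (f z - series (fun n => a n * z ^+ n) N) * g z.
  rewrite [series (fun n => a n * _) N]big_mkord mulrBl mulr_suml addrCA -sumrB.
  rewrite -mulrN1 mulr_suml; congr (_ + _); apply: eq_bigr => i _; ring.
apply: le_trans (normcD_le _ _) _; rewrite /M [leRHS]mulrDl; apply: lerD.
  apply: le_trans (normc_sum _ _ _) _.
  apply: (@le_trans _ _ (\sum_(i < N) K * L / (1 - q) * q ^+ N)).
    apply: ler_sum => i _; rewrite ComplexField.Normc.normcM.
    apply: le_trans (ler_pM _ _ (aK i) (series_tail_le (N - i) L0 q01 bL (gb _ zD))) _;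
      rewrite ?normc_ge0//.
    have -> : q ^+ N = q ^+ i * q ^+ (N - i).
      by rewrite -exprD subnKC// ltnW.
    by rewrite le_eqVlt; apply/orP; left; apply/eqP; ring.
  rewrite sumr_const card_ord -[leLHS]mulr_natl mulrCA ler_wpM2l//.
    by rewrite divr_ge0 ?mulr_ge0// ltW.
  by rewrite ler_wpM2r ?exprn_ge0// ler_nat.
rewrite ComplexField.Normc.normcM mulrAC ler_wpM2r ?normc_ge0//.
apply: le_trans (series_tail_le N K0 q01 aK (fa _ zD)) _.
rewrite mulrCA mulrC ler_wpM2l ?divr_ge0 ?(ltW q10)//.
by rewrite ler_peMl ?exprn_ge0// ler1n.
Qed.

Lemma power_series_on_disc_exprn f a n : power_series_on_disc f a ->
  power_series_on_disc (fun z => f z ^+ n) (power_coef a n).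
Proof.
move=> fa; elim: n => [|n IH].
  move=> z _; rewrite expr0; apply: (@cvg_near_cst _ _ _ _ _ (_ : ProperFilter _)).
  near=> N; have N0 : (0 < N)%N by near: N; exact: nbhs_infty_gt.
  rewrite /series /= big_mkord (bigD1 (Ordinal N0))//= expr0 mulr1 big1 ?addr0//.
  by move=> i; rewrite -val_eqE /= => /negPf ->; rewrite mul0r.
rewrite (_ : (fun z => _) = (fun z => f z * f z ^+ n)); last first.
  by apply/funext => z; rewrite exprS.
exact: power_series_on_discM.
Unshelve. all: by end_near. Qed.

End PowerSeriesCalculus.

(** * Termwise differentiation of power series *)

Section Derivative.
Context {R : realType}.
Local Notation C := R[i].
Implicit Types (a : nat -> C) (f : C -> C) (z h d : C).

(** The remainders satisfy e_(n+1) = w e_n + n (w - z)^2 z^(n-1), and n^2 + n <= (n+1)^2. The factor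
    [t ^+ 2] on the left avoids the exponent n - 2. *)
Lemma expr_diff2_le z w (t : R) n : normc z <= t -> normc w <= t ->
  normc (w ^+ n - z ^+ n - (w - z) * (n%:R * z ^+ n.-1)) * t ^+ 2
    <= n%:R ^+ 2 * t ^+ n * normc (w - z) ^+ 2.
Proof.
move=> zt wt; have t0 : 0 <= t by apply: le_trans zt; exact: normc_ge0.
elim: n => [|n IH].
  by rewrite !expr0 subrr mul0r mulr0 subrr ComplexField.Normc.normc0 expr0n !mul0r.
set e := _ - _ - _ in IH.
have -> : w ^+ n.+1 - z ^+ n.+1 - (w - z) * (n.+1%:R * z ^+ n.+1.-1) =
    w * e + (w - z) ^+ 2 * (n%:R * z ^+ n.-1).
  rewrite /e; case: (n) => [|m]; first by rewrite !expr0 !expr1; ring.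
  by rewrite /= -[m.+2%:R]natr1 -[m.+1%:R]natr1 !exprS; ring.
have h1 : normc (w * e) * t ^+ 2 <=
    n%:R ^+ 2 * t ^+ n.+1 * normc (w - z) ^+ 2.
  rewrite ComplexField.Normc.normcM -mulrA exprS.
  apply: (@le_trans _ _ (t * (n%:R ^+ 2 * t ^+ n * normc (w - z) ^+ 2))).
    by rewrite ler_pM ?normc_ge0// mulr_ge0 ?normc_ge0 ?sqr_ge0.
  by rewrite [t ^+ n.+1]exprS le_eqVlt; apply/orP; left; apply/eqP; ring.
have h2 : normc ((w - z) ^+ 2 * (n%:R * z ^+ n.-1)) * t ^+ 2 <=
    n%:R * t ^+ n.+1 * normc (w - z) ^+ 2.
  rewrite ComplexField.Normc.normcM normcX ComplexField.Normc.normcM normc_nat normcX.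
  case: (n) => [|m] /=; first by rewrite !(mul0r, mulr0).
  rewrite mulrAC [leRHS]mulrC -[leLHS]mulrA ler_wpM2l ?sqr_ge0//.
  rewrite mulrCA ler_wpM2l//.
  rewrite (_ : t ^+ m.+2 = t ^+ 2 * t ^+ m); last by rewrite -exprD add2n.
  by rewrite ler_wpM2l ?sqr_ge0// lerXn2r ?nnegrE ?normc_ge0.
apply: (le_trans (ler_wpM2r (sqr_ge0 t) (normcD_le _ _))); rewrite mulrDl.
apply: (le_trans (lerD h1 h2)).
set T := t ^+ n.+1; set H := normc (w - z) ^+ 2.
have TH : 0 <= T * H by rewrite mulr_ge0 ?sqr_ge0 ?exprn_ge0.
rewrite -[n.+1%:R]natr1 -subr_ge0.
rewrite (_ : _ - _ = (n%:R + 1) * (T * H)); last by ring.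
by rewrite mulr_ge0// addr_ge0.
Qed.

Lemma series_derivE a z N :
  \sum_(n < N.+1) a n * (n%:R * z ^+ n.-1) =
  series (fun n => n.+1%:R * a n.+1 * z ^+ n) N.
Proof.
rewrite big_ord_recl mul0r mulr0 add0r /series /= big_mkord.
by apply: eq_bigr => i _; rewrite /bump /= add1n; ring.
Qed.

(** A quadratic remainder makes the error of the quotient at most [K * normc h]. *)
Lemma cvg_difference_quotient f z d (K e0 : R) : 0 <= K -> 0 < e0 ->
  (forall h, normc h < e0 -> normc (f (z + h) - f z - h * d) <= K * normc h ^+ 2) ->
  (fun h => h^-1 *: ((f \o shift z) (h *: (1 : C)) - f z)) @ 0^' --> d.
Proof.
move=> K0 e00 fd; apply/cvgrPdist_lt => e e_gt0.
have eE : e = (complex.Re e)%:C by rewrite RRe_real// gtr0_real.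
have e0' : 0 < complex.Re e by rewrite -ltcR -eE.
(* [K + 1] keeps the denominator positive when [K = 0]. *)
pose r := Num.min e0 (complex.Re e / (K + 1)).
have K1 : 0 < K + 1 by lra.
have r0 : 0 < r by rewrite lt_min e00 divr_gt0.
near=> h.
have hN0 : h != 0 by near: h; exact: nbhs_dnbhs_neq.
have : `|h| < r%:C by near: h; apply: dnbhs0_lt; rewrite ltcR.
rewrite normC_normc ltcR lt_min => /andP[he0 hr].
have -> : d - h^-1 *: ((f \o shift z) (h *: 1) - f z) =
    h^-1 * - (f (z + h) - f z - h * d).
  rewrite /= [h *: 1]mulr1 [h + z]addrC.
  rewrite -[d in LHS](mulKf hN0) -[_ *: _]/(_ * _); ring.
have nh : 0 < normc h.
  rewrite lt_neqAle normc_ge0 andbT eq_sym; apply: contra hN0 => /eqP.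
  by move/ComplexField.Normc.eq0_normc ->.
rewrite eE normC_normc ltcR ComplexField.Normc.normcM normcN.
rewrite ComplexField.Normc.normcV mulrC ltr_pdivrMr//.
apply: le_lt_trans (fd _ he0) _; rewrite expr2 mulrA ltr_pM2r//.
rewrite ltr_pdivlMr// in hr; apply: le_lt_trans hr.
by rewrite mulrC ler_wpM2l ?normc_ge0//; lra.
Unshelve. all: by end_near. Qed.

(** With [t] strictly between [normc z] and 1, [expr_diff2_le] bounds the remainder of the [n]-th
    term by n^2 K q^n |h|^2 / t^2, and these bounds sum to a multiple of |h|^2. *)
Lemma power_series_derivative f a z : power_series_on_disc f a ->
  unit_disc R z -> exists d : C,
  [/\ series (fun n => n.+1%:R * a n.+1 * z ^+ n) @ \oo --> d,
      derivable f z 1 & f^`()%classic z = d].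
Proof.
move=> fa zD; have zn := zD; rewrite disc_normc in zn.
pose t := (1 + normc z) / 2; have z0 := normc_ge0 z.
have t0 : 0 < t by rewrite /t; lra.
have zt : normc z < t by rewrite /t; lra.
have t1 : t < 1 by rewrite /t; lra.
have t01 : 0 <= t < 1 by rewrite (ltW t0).
have [K [q [K0 q01 aK]]] := power_series_geometric fa t01.
have [L [s [L0 s01 qL]]] := natr2_geometric_le q01.
have /andP[s0 s1] := s01; have /andP[q0 q1] := q01.
have /cvg_ex[d dE] : cvgn (series (fun n => n.+1%:R * a n.+1 * z ^+ n : C)).
  apply: (@cvg_series_geometric _ _ (K * L * s / t) s) => // n.
  rewrite !ComplexField.Normc.normcM normcX normc_nat.
  have -> : K * L * s / t * s ^+ n = K * (L * s ^+ n.+1) / t by rewrite exprS; ring.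
  rewrite ler_pdivlMr// -!mulrA.
  apply: (@le_trans _ _ (n.+1%:R * (normc (a n.+1) * t ^+ n.+1))).
    rewrite exprSr !ler_wpM2l ?normc_ge0// ler_wpM2r ?(ltW t0)//.
    by rewrite lerXn2r ?nnegrE ?(ltW t0) ?(ltW zt).
  apply: (le_trans (ler_wpM2l (ler0n _ _) (aK _))).
  rewrite mulrCA ler_wpM2l//.
  apply: le_trans (qL n.+1); rewrite ler_wpM2r ?exprn_ge0//.
  by rewrite -natrX ler_nat (leq_trans (leqnSn _))// -mulnn leq_pmulr.
have fd : (fun h => h^-1 *: ((f \o shift z) (h *: (1 : C)) - f z)) @ 0^' --> d.
  pose M := K * L / (1 - s) / t ^+ 2.
  have s10 : 0 < 1 - s by rewrite subr_gt0.
  apply: (@cvg_difference_quotient _ _ _ M (t - normc z)).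
  - by rewrite /M divr_ge0 ?sqr_ge0// divr_ge0 ?(ltW s10)// mulr_ge0.
  - by rewrite subr_gt0.
  move=> h hz; have zht : normc (z + h) <= t.
    by apply: le_trans (normcD_le _ _) _; lra.
  have zhD : unit_disc R (z + h) by rewrite disc_normc (le_lt_trans zht).
  (* Partial sums of the remainder: the constant term drops out of the derivative, so [N.+1] terms
     of [f] match [N] terms there. *)
  pose v N : C := series (fun n => a n * (z + h) ^+ n) N.+1
    - series (fun n => a n * z ^+ n) N.+1
    - h * series (fun n => n.+1%:R * a n.+1 * z ^+ n) N.
  have vl : v @ \oo --> (f (z + h) - f z - h * d : C).
    apply: cvgB; first apply: cvgB.
    - by rewrite (cvg_shiftS (series (fun n => a n * (z + h) ^+ n))); exact: fa.
    - by rewrite (cvg_shiftS (series (fun n => a n * z ^+ n))); exact: fa.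
    - exact: cvgMr.
  rewrite -[X in normc X]subr0; apply: (normc_lim_le vl); near=> N.
  rewrite subr0 /v -series_derivE mulr_sumr [series _ N.+1]big_mkord.
  rewrite [series (fun n => a n * z ^+ n) N.+1]big_mkord -!sumrB.
  apply: le_trans (normc_sum _ _ _) _.
  rewrite /M mulrAC ler_pdivlMr ?exprn_gt0// mulr_suml.
  apply: (@le_trans _ _ (\sum_(n < N.+1) K * L * normc h ^+ 2 * s ^+ n)).
    apply: ler_sum => n _.
    have -> : a n * (z + h) ^+ n - a n * z ^+ n - h * (a n * (n%:R * z ^+ n.-1))
        = a n * ((z + h) ^+ n - z ^+ n - (z + h - z) * (n%:R * z ^+ n.-1)).
      by ring.
    rewrite ComplexField.Normc.normcM -[leLHS]mulrA.
    apply: le_trans (ler_wpM2l (normc_ge0 _) (expr_diff2_le n (ltW zt) zht)) _.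
    have -> : z + h - z = h by ring.
    have -> : normc (a n) * (n%:R ^+ 2 * t ^+ n * normc h ^+ 2) =
      n%:R ^+ 2 * (normc (a n) * t ^+ n) * normc h ^+ 2 by ring.
    rewrite [leRHS]mulrAC ler_wpM2r ?sqr_ge0//.
    apply: le_trans (ler_wpM2l (sqr_ge0 _) (aK n)) _.
    rewrite mulrCA -[leRHS]mulrA ler_wpM2l//; apply: le_trans (qL n).
    by rewrite ler_wpM2r ?exprn_ge0// lerXn2r ?nnegrE// ler_nat.
  rewrite -mulr_sumr [leRHS]mulrAC ler_wpM2l//.
    by rewrite mulr_ge0 ?sqr_ge0// mulr_ge0.
  by have := sum_geometric_le 0 N.+1 s01; rewrite big_mkord expr0 mul1r.
exists d; split; first exact: dE.
  by apply/cvg_ex; exists d; exact: fd.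
by rewrite derive1E; apply: cvg_lim fd; exact: norm_hausdorff.
Unshelve. all: by end_near. Qed.

Lemma power_series_holomorphic f a :
  power_series_on_disc f a -> holomorphic_on_disc f.
Proof. by move=> fa z zD; have [d []] := power_series_derivative fa zD. Qed.

End Derivative.

(** * Coefficientwise limits and the Dirichlet norm *)

Lemma cvg_series_pointwise (K : numFieldType) (V : normedModType K)
    (F : nat -> nat -> V) (l : nat -> V) N :
  (forall k, F m k @[m --> \oo] --> l k) ->
  series (F m) N @[m --> \oo] --> series l N.
Proof.
move=> Fl; elim: N => [|N IH].
  rewrite (_ : (fun m => _) = fun=> series l 0%N); first exact: cvg_cst.
  by apply/funext => m; rewrite /series /= !big_geq.
rewrite seriesSr (_ : (fun m => _) = (fun m => series (F m) N) \+ F^~ N).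
  exact: cvgD IH (Fl N).
by apply/funext => m /=; rewrite seriesSr.
Qed.

Section SequenceNormLimit.
Context {R : realType} (alpha : R).
Local Notation C := R[i].
Implicit Types (u a : nat -> C).

Definition seq_norm u : R := Num.sqrt (seq_sqnorm alpha u).

Lemma seq_norm_ge0 u : 0 <= seq_norm u.
Proof. exact: sqrtr_ge0. Qed.

Lemma seq_normK u : square_summable alpha u ->
  seq_norm u ^+ 2 = seq_sqnorm alpha u.
Proof. by move=> su; rewrite sqr_sqrtr// seq_sqnorm_ge0. Qed.

Lemma seq_norm_le u (B : R) : 0 <= B -> seq_sqnorm alpha u <= B ^+ 2 ->
  seq_norm u <= B.
Proof.
by move=> B0 uB; rewrite -[leRHS]ger0_norm// -sqrtr_sqr ler_wsqrtr.
Qed.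

Lemma normc_le_seq_norm u k : 0 < alpha < 1 -> square_summable alpha u ->
  normc (u k) <= seq_norm u.
Proof.
move=> alpha01 su; rewrite -(@ler_pXn2r _ 2)// ?nnegrE ?normc_ge0 ?seq_norm_ge0//.
rewrite seq_normK//; apply: le_trans (seq_sqnorm_partial k.+1 su).
rewrite seriesSr; apply: (@le_trans _ _ (dirichlet_weight alpha k * normc (u k) ^+ 2)).
  by rewrite ler_peMl ?sqr_ge0// dirichlet_weight_ge1.
rewrite lerDr /series sumr_ge0// => i _.
by rewrite mulr_ge0 ?sqr_ge0// ltW// dirichlet_weight_gt0.
Qed.

Lemma cvg_normc (v : nat -> C) (l : C) :
  v @ \oo --> l -> (fun m => normc (v m)) @ \oo --> normc l.
Proof.
move=> /cvgn_normc vl; apply/cvgrPdist_lt => e e0.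
apply: filterS (vl _ e0) => m; apply: le_lt_trans.
rewrite ler_norml; apply/andP; split.
  rewrite lerNl opprB lerBlDr; apply: le_trans (normcD_le _ _).
  by rewrite subrK.
rewrite lerBlDr normcB_sym; apply: le_trans (normcD_le _ _).
by rewrite subrK.
Qed.

(** A Fatou property: each partial sum of the squared norm passes to the coefficientwise limit. It
    serves in place of a completeness argument. *)
Lemma seq_norm_lim (v : nat -> nat -> C) u (B : R) : 0 <= B ->
  (forall m, square_summable alpha (v m)) ->
  (forall m, seq_norm (v m) <= B) ->
  (forall k, (fun m => v m k) @ \oo --> u k) ->
  square_summable alpha u /\ seq_norm u <= B.
Proof.
move=> B0 sv vB vu.
have [su uB] : square_summable alpha u /\ seq_sqnorm alpha u <= B ^+ 2.
  apply: seq_sqnorm_bound => n.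
  pose w (m : nat) := series (fun k => dirichlet_weight alpha k * normc (v m k) ^+ 2) n.
  have wl : w @ \oo --> series (fun k => dirichlet_weight alpha k * normc (u k) ^+ 2) n.
    apply: cvg_series_pointwise => k; apply: cvgMr.
    by apply: cvgM; exact: cvg_normc (vu k).
  rewrite -(cvg_lim _ wl)//; apply: limr_le; first by apply/cvg_ex; eexists; exact: wl.
  near=> m; apply: le_trans (seq_sqnorm_partial n (sv m)) _.
  by rewrite -seq_normK// lerXn2r ?nnegrE ?seq_norm_ge0.
by split=> //; exact: seq_norm_le.
Unshelve. all: by end_near. Qed.

Lemma seq_norm_sum (e : nat -> nat -> C) (y : nat -> C) m :
  (forall n, square_summable alpha (e n)) ->
  square_summable alpha (fun k => \sum_(n < m) y n * e n k) /\
  seq_norm (fun k => \sum_(n < m) y n * e n k)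
    <= \sum_(n < m) normc (y n) * seq_norm (e n).
Proof.
move=> se; elim: m => [|m [sm IH]].
  rewrite (_ : (fun k => _) = fun=> 0); last by apply/funext => k; rewrite big_ord0.
  split; first exact: square_summable0.
  rewrite big_ord0; apply: seq_norm_le => //; rewrite expr0n /=.
  apply: (proj2 (@seq_sqnorm_bound _ _ _ 0 _)) => n.
  rewrite /series /= big1// => i _.
  by rewrite expr0n addr0 sqrtr0 expr0n mulr0.
rewrite (_ : (fun k => _) =
    (fun k => (fun k => \sum_(n < m) y n * e n k) k + (fun k => y m * e m k) k));
  last by apply/funext => k; rewrite big_ord_recr.
have [se' sE] := square_summableZ (y m) (se m).
split; first exact: square_summableD.
apply: le_trans (seq_norm_triangle sm se') _.
rewrite big_ord_recr /=; apply: lerD => //.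
rewrite sE sqrtrM ?sqr_ge0// sqrtr_sqr ger0_norm ?normc_ge0//.
Qed.

End SequenceNormLimit.

(** * The operator on bounded sequences *)

Section Superposition.
Context {R : realType} (alpha : R) (phi : R[i] -> R[i]) (b : nat -> R[i]).
Context (K s : R).
Local Notation C := R[i].
Hypothesis alpha01 : 0 < alpha < 1.
Hypothesis phib : power_series_on_disc phi b.
Hypothesis K0 : 0 <= K.
Hypothesis s01 : 0 <= s < 1.
Hypothesis sb : forall n, square_summable alpha (power_coef b n).
Hypothesis nb : forall n, n.+1%:R * seq_norm alpha (power_coef b n) <= K * s ^+ n.
Implicit Types (y : nat -> C) (z : C) (M : R).

(** Each coefficient is a limit of its own; [superposition_power_series] shows that these are the
    coefficients of [superposition y]. *)
Definition superposition_coef y : nat -> C :=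
  fun k => limn (series (fun n => n.+1%:R * y n * power_coef b n k)).

(** When [y n] is the Taylor coefficient of [f] of index [n.+1], this is the derivative of [f] at
    [phi z]. *)
Definition superposition y z : C :=
  limn (series (fun n => n.+1%:R * y n * phi z ^+ n)).

Lemma cvg_superposition_coef y M k : (forall n, normc (y n) <= M) ->
  series (fun n => n.+1%:R * y n * power_coef b n k) @ \oo -->
    superposition_coef y k.
Proof.
move=> yM; apply: (@cvg_series_geometric _ _ (M * K) s) => // n.
rewrite !ComplexField.Normc.normcM normc_nat mulrAC mulrC -mulrA.
have M0 : 0 <= M by apply: le_trans (yM 0%N); exact: normc_ge0.
apply: ler_pM => //; rewrite ?mulr_ge0 ?normc_ge0//.
by apply: le_trans (nb n); rewrite ler_wpM2l// normc_le_seq_norm.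
Qed.

(** All coefficients of the [n]-th power of [phi] are bounded by its norm, so its series at [z] is
    dominated by a geometric one of ratio [normc z]. *)
Lemma power_coef_tail_le n z N : unit_disc R z ->
  normc (phi z ^+ n - series (fun k => power_coef b n k * z ^+ k) N) <=
  seq_norm alpha (power_coef b n) * (normc z ^+ N / (1 - normc z)).
Proof.
move=> zD; have zn := zD; rewrite disc_normc in zn.
apply: series_tail_le; rewrite ?seq_norm_ge0 ?normc_ge0//.
  move=> k; rewrite ComplexField.Normc.normcM normcX ler_wpM2r ?exprn_ge0 ?normc_ge0//.
  exact: normc_le_seq_norm.
exact: power_series_on_disc_exprn.
Qed.

Lemma cvg_superposition y M z : (forall n, normc (y n) <= M) ->
  unit_disc R z ->
  series (fun n => n.+1%:R * y n * phi z ^+ n) @ \oo --> superposition y z.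
Proof.
move=> yM zD; have zn := zD; rewrite disc_normc in zn.
have M0 : 0 <= M by apply: le_trans (yM 0%N); exact: normc_ge0.
apply: (@cvg_series_geometric _ _ (M * K / (1 - normc z)) s) => // n.
rewrite !ComplexField.Normc.normcM normc_nat.
(* The tail from index 0 is the whole series, which bounds the [n]-th power of [phi z] itself. *)
have := power_coef_tail_le n 0 zD; rewrite /series /= big_geq// subr0 expr0 mul1r => h.
have -> : M * K / (1 - normc z) * s ^+ n = M * (K * s ^+ n / (1 - normc z)) by ring.
rewrite mulrAC mulrC; apply: ler_pM; rewrite ?mulr_ge0 ?normc_ge0//.
apply: (le_trans (ler_wpM2l (ler0n _ _) h)).
by rewrite mulrA ler_wpM2r ?invr_ge0 ?subr_ge0 ?(ltW zn)//.
Qed.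

(** The sums over [n] and [k] are interchanged for finitely many [n]. The error is then a
    combination of tails of powers of [phi], bounded by [D * normc z ^+ N] uniformly in the number
    of terms, so the bound survives the limit. *)
Lemma superposition_power_series y M : (forall n, normc (y n) <= M) ->
  power_series_on_disc (superposition y) (superposition_coef y).
Proof.
move=> yM z zD; have zn := zD; rewrite disc_normc in zn.
have M0 : 0 <= M by apply: le_trans (yM 0%N); exact: normc_ge0.
have z10 : 0 < 1 - normc z by rewrite subr_gt0.
pose D := M * K / (1 - s) / (1 - normc z).
apply: (@cvgn_normc_le _ _ _ (fun N => D * normc z ^+ N)); last first.
  by apply: (@cvg_geometric _ D (normc z)); rewrite ger0_norm ?normc_ge0.
move=> N; pose v m : C := 
    series (fun k => series (fun n => n.+1%:R * y n * power_coef b n k) m * z ^+ k) N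
  - series (fun n => n.+1%:R * y n * phi z ^+ n) m.
have vl : v @ \oo --> (series (fun n => superposition_coef y n * z ^+ n) N
    - superposition y z : C).
  apply: cvgB; last exact: cvg_superposition yM zD.
  apply: cvg_series_pointwise => k; apply: cvgMl.
  exact: cvg_superposition_coef yM.
rewrite -[X in normc X]subr0; apply: (normc_lim_le vl); near=> m.
rewrite subr0.
have -> : v m = - \sum_(n < m) n.+1%:R * y n *
    (phi z ^+ n - series (fun k => power_coef b n k * z ^+ k) N).
  rewrite /v ![series _ _]big_mkord.
  under eq_bigr do rewrite [series _ _]big_mkord mulr_suml.
  rewrite exchange_big -sumrB -sumrN; apply: eq_bigr => n _ /=.
  rewrite mulrBr opprB [series _ _]big_mkord mulr_sumr; congr (_ - _).
  by apply: eq_bigr => k _; rewrite mulrA.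
rewrite normcN; apply: le_trans (normc_sum _ _ _) _.
apply: (@le_trans _ _ (\sum_(n < m) (M * K * (normc z ^+ N / (1 - normc z))) * s ^+ n)).
  apply: ler_sum => n _; rewrite !ComplexField.Normc.normcM normc_nat.
  apply: le_trans (ler_wpM2l _ (power_coef_tail_le n N zD)) _.
    by rewrite mulr_ge0 ?normc_ge0.
  rewrite mulrA [leRHS]mulrAC ler_wpM2r ?divr_ge0 ?exprn_ge0 ?normc_ge0 ?(ltW z10)//.
  rewrite mulrAC mulrC -[leRHS]mulrA.
  by apply: ler_pM; rewrite ?normc_ge0 ?mulr_ge0 ?seq_norm_ge0.
rewrite -mulr_sumr.
have := sum_geometric_le 0 m s01; rewrite big_mkord expr0 mul1r => h.
have MK : 0 <= M * K * (normc z ^+ N / (1 - normc z)).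
  by rewrite !mulr_ge0 ?exprn_ge0 ?invr_ge0 ?normc_ge0 ?(ltW z10).
apply: (le_trans (ler_wpM2l MK h)).
by rewrite /D le_eqVlt; apply/orP; left; apply/eqP; ring.
Unshelve. all: by end_near. Qed.

(** The finite sums stay in the ball of radius [B], and [seq_norm_lim] passes to the limit. [B] is
    kept apart from [M] because continuity needs a norm bound that is small when [y] is small
    against the geometric weights. *)
Lemma superposition_coef_norm y M (B : R) : 0 <= B ->
  (forall n, normc (y n) <= M) ->
  (forall m, \sum_(n < m) normc (y n) * (K * s ^+ n) <= B) ->
  square_summable alpha (superposition_coef y) /\
  seq_norm alpha (superposition_coef y) <= B.
Proof.
move=> B0 yM yB.
pose v m k : C := \sum_(n < m) n.+1%:R * y n * power_coef b n k.
have sv m := seq_norm_sum (fun n => n.+1%:R * y n) m sb.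
apply: (seq_norm_lim (v := v)) => // [m|m|k].
- by case: (sv m).
- apply: le_trans (yB m); apply: (le_trans (sv m).2); apply: ler_sum => n _.
  rewrite ComplexField.Normc.normcM normc_nat mulrAC mulrC.
  by rewrite ler_wpM2l ?normc_ge0.
- rewrite (_ : (fun m => _) = series (fun n => n.+1%:R * y n * power_coef b n k)).
    exact: cvg_superposition_coef yM.
  by apply/funext => m; rewrite /series /= big_mkord.
Qed.

End Superposition.

(** * The operator on the Dirichlet space and its compactness *)

Section Operator.
Context {R : realType} (alpha : R) (phi : R[i] -> R[i]) (b : nat -> R[i]).
Context (K s : R).
Local Notation C := R[i].
Hypothesis alpha01 : 0 < alpha < 1.
Hypothesis phib : power_series_on_disc phi b.
Hypothesis phiD : forall z, unit_disc R z -> unit_disc R (phi z).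
Hypothesis K0 : 0 <= K.
Hypothesis s01 : 0 <= s < 1.
Hypothesis sb : forall n, square_summable alpha (power_coef b n).
Hypothesis nb : forall n, n.+1%:R * seq_norm alpha (power_coef b n) <= K * s ^+ n.
Implicit Types (y : nat -> C) (z : C) (M : R).

Lemma sum_geometric_bound y M m : 0 <= M -> (forall n, normc (y n) <= M) ->
  \sum_(n < m) normc (y n) * (K * s ^+ n) <= M * (K / (1 - s)).
Proof.
move=> M0 yM; apply: (@le_trans _ _ (\sum_(n < m) M * K * s ^+ n)).
  apply: ler_sum => n _; rewrite -[leRHS]mulrA ler_wpM2r//.
  by rewrite mulr_ge0 ?exprn_ge0//; case/andP: s01.
rewrite -mulr_sumr -[leLHS]mulrA; do 2 apply: ler_wpM2l => //.
by have := sum_geometric_le 0 m s01; rewrite big_mkord expr0 mul1r.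
Qed.

Let geom_ge0 : 0 <= K / (1 - s).
Proof. by rewrite divr_ge0// subr_ge0 ltW//; case/andP: s01. Qed.

(** Extended by zero outside the disc, as membership in [dirichlet_pred] requires. *)
Definition superposition_fun y z : C :=
  if `[< unit_disc R z >] then superposition phi y z else 0.

Lemma superposition_in_dirichlet y M : 0 <= M -> (forall n, normc (y n) <= M) ->
  superposition_fun y \in dirichlet_pred alpha.
Proof.
move=> M0 yM; have ps : power_series_on_disc (superposition_fun y) (superposition_coef b y).
  move=> z zD; rewrite /superposition_fun asboolT//.
  exact: (superposition_power_series alpha01 phib K0 s01 sb nb yM zD).
apply/dirichlet_predP; split; last by move=> z zD; rewrite /superposition_fun asboolF.
split; first exact: power_series_holomorphic ps.
exists (superposition_coef b y) => //.
have B0 : 0 <= M * (K / (1 - s)) by rewrite mulr_ge0.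
have yB m := sum_geometric_bound m M0 yM.
by case: (superposition_coef_norm alpha01 s01 sb nb B0 yM yB).
Qed.

(** The default 0 of [insubd] makes this a total function of [y]; for bounded [y] the default is
    never taken. *)
Definition dirichlet_superposition y : dirichlet alpha :=
  insubd (0 : dirichlet alpha) (superposition_fun y).

Lemma dirichlet_superpositionE y M : 0 <= M -> (forall n, normc (y n) <= M) ->
  dirichlet_superposition y = superposition_fun y :> (C -> C).
Proof.
move=> M0 yM; rewrite -[LHS]/(val (dirichlet_superposition y)) val_insubd.
by rewrite (superposition_in_dirichlet M0 yM).
Qed.

Lemma dirichlet_superposition_linear c y y' M : 0 <= M ->
  (forall n, normc (y n) <= M) -> (forall n, normc (y' n) <= M) ->
  dirichlet_superposition (fun n => c * y n + y' n) =
  c *: dirichlet_superposition y + dirichlet_superposition y'.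
Proof.
move=> M0 yM y'M; have cM n : normc (c * y n + y' n) <= normc c * M + M.
  apply: le_trans (normcD_le _ _) _; rewrite lerD//.
  by rewrite ComplexField.Normc.normcM ler_wpM2l ?normc_ge0.
have cM0 : 0 <= normc c * M + M by rewrite addr_ge0 ?mulr_ge0 ?normc_ge0.
apply: val_inj; apply/funext => z.
rewrite -[RHS]/(c * dirichlet_superposition y z + dirichlet_superposition y' z).
rewrite -[LHS]/(dirichlet_superposition _ z).
rewrite (dirichlet_superpositionE cM0 cM) (dirichlet_superpositionE M0 yM).
rewrite (dirichlet_superpositionE M0 y'M) /superposition_fun.
case: asboolP => zD; last by rewrite mulr0 addr0.
apply: cvg_lim; first exact: norm_hausdorff.
have h := cvg_superposition alpha01 phib s01 sb nb yM zD.
have h' := cvg_superposition alpha01 phib s01 sb nb y'M zD.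
rewrite (_ : series _ = (fun N => c * series (fun n => n.+1%:R * y n * phi z ^+ n) N)
    \+ series (fun n => n.+1%:R * y' n * phi z ^+ n)).
  by apply: cvgD h'; apply: cvgMr; exact: h.
apply/funext => N; rewrite /series /= mulr_sumr -big_split; apply: eq_bigr => n _ /=.
by ring.
Qed.

Lemma dirichlet_superposition_norm y M B : 0 <= M -> 0 <= B ->
  (forall n, normc (y n) <= M) ->
  (forall m, \sum_(n < m) normc (y n) * (K * s ^+ n) <= B) ->
  `|dirichlet_superposition y| <= B%:C.
Proof.
move=> M0 B0 yM yB; rewrite dirichlet_norm_normr dirichlet_normE lecR.
rewrite (@taylor_coefE _ _ (superposition_coef b y)).
  by case: (superposition_coef_norm alpha01 s01 sb nb B0 yM yB).
move=> z zD; rewrite (dirichlet_superpositionE M0 yM) /superposition_fun asboolT//.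
exact: (superposition_power_series alpha01 phib K0 s01 sb nb yM zD).
Qed.

Lemma dirichlet_superpositionB_norm y y' M B : 0 <= M -> 0 <= B ->
  (forall n, normc (y n) <= M) -> (forall n, normc (y' n) <= M) ->
  (forall m, \sum_(n < m) normc (y n - y' n) * (K * s ^+ n) <= B) ->
  `|dirichlet_superposition y - dirichlet_superposition y'| <= B%:C.
Proof.
move=> M0 B0 yM y'M yB; rewrite -normrN opprB addrC -scaleN1r.
rewrite -(dirichlet_superposition_linear (-1) M0 yM y'M).
have E n : normc (-1 * y n + y' n) = normc (y n - y' n).
  by rewrite mulN1r addrC normcB_sym.
apply: (@dirichlet_superposition_norm _ (M + M)) => //.
- by rewrite addr_ge0.
- by move=> n; rewrite E (le_trans (normcD_le _ _))// lerD// normcN.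
- by move=> m; under eq_bigr do rewrite E; exact: yB.
Qed.

(* Sequences are parametrised by real and imaginary parts, so that Tychonoff
   only has to be fed real segments. *)
Definition complex_of_family (p : nat * bool -> R) : nat -> C :=
  fun n => p (n, false) +i* p (n, true).

Lemma normc_ReIm_le (x y d : R) : `|x| <= d -> `|y| <= d ->
  normc (x +i* y) <= 2 * d.
Proof.
move=> xd yd; have d0 : 0 <= d by apply: le_trans xd.
rewrite /normc /= -[leRHS]ger0_norm ?mulr_ge0// -sqrtr_sqr ler_wsqrtr//.
have : x ^+ 2 <= d ^+ 2 by rewrite -real_normK ?num_real// lerXn2r ?nnegrE.
have : y ^+ 2 <= d ^+ 2 by rewrite -real_normK ?num_real// lerXn2r ?nnegrE.
have := sqr_ge0 d; nra.
Qed.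

Definition family_box M : set (prod_topology (fun _ : nat * bool => R)) :=
  [set p | forall i, `[- M, M]%classic (p i)].

Lemma family_box_compact M : compact (family_box M).
Proof.
apply: (@tychonoff (nat * bool)%type (fun=> R) (fun=> `[- M, M]%classic)) => _.
exact: segment_compact.
Qed.

Lemma family_box_normc M p n : family_box M p ->
  normc (complex_of_family p n) <= 2 * M.
Proof.
move=> pM; have pi i : `|p i| <= M.
  by have := pM i; rewrite /= in_itv /= -ler_norml.
exact: normc_ReIm_le.
Qed.

(** The norm of a difference is controlled by a geometrically weighted sum, split at [N]: from [N]
    on the box bound suffices, and below [N] finitely many coordinates matter, which are close in a
    product neighbourhood. *)
Lemma continuous_dirichlet_superposition M : 0 <= M ->
  {within family_box M, continuous (fun p => dirichlet_superposition (complex_of_family p))}.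
Proof.
move=> M0; apply/subspace_continuousP => p pM.
apply/cvgrPdist_le => e e_gt0.
have eE : e = (complex.Re e)%:C by rewrite RRe_real// gtr0_real.
have e0 : 0 < complex.Re e by rewrite -ltcR -eE.
set e' := complex.Re e in eE e0; clearbody e'.
have /andP[s0 s1] := s01; have s10 : 0 < 1 - s by rewrite subr_gt0.
pose G := K / (1 - s).
have G1 : 0 < G + 1 by rewrite ltr_wpDl.
(* Chosen so that the close coordinates contribute [2 * d * G <= e' / 2]. *)
pose d := e' / (4 * (G + 1)).
have d0 : 0 < d by rewrite divr_gt0// mulr_gt0.
have d20 : 0 <= 2 * d by rewrite mulr_ge0 ?(ltW d0).
have [N Ns] : exists N, 4 * M * G * s ^+ N <= e' / 2.
  have : (fun n => 4 * M * G * s ^+ n) @ \oo --> (0 : R).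
    by apply: (@cvg_geometric _ (4 * M * G) s); rewrite ger0_norm.
  have e20 : 0 < e' / 2 by rewrite divr_gt0.
  move=> /cvgrPdist_le/(_ _ e20)[N _ /(_ N (leqnn N))] /=.
  rewrite sub0r normrN => h; exists N; apply: le_trans h; exact: ler_norm.
pose c (k : 'I_N * bool) := (nat_of_ord k.1, k.2).
have near_p : \forall q \near p, forall k, `|p (c k) - q (c k)| <= d.
  apply: (@filter_forall _ _ (fun k => [set q | `|p (c k) - q (c k)| <= d]) (nbhs p)) => k.
  have pc := @proj_continuous (nat * bool)%type (fun=> R) (c k) p.
  exact: (@cvgr_dist_le _ _ _ _ (nbhs_filter p) (proj (c k)) _ pc d d0).
rewrite near_withinE; apply: filterS near_p => p' pp' p'M.
rewrite eE; apply: (@dirichlet_superpositionB_norm _ _ (2 * M)).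
- by rewrite mulr_ge0.
- exact: ltW.
- by move=> n; exact: family_box_normc.
- by move=> n; exact: family_box_normc.
move=> m; set y := complex_of_family p; set y' := complex_of_family p'.
have y4 n : normc (y n - y' n) <= 4 * M.
  apply: le_trans (normcD_le _ _) _; rewrite normcN.
  by have := family_box_normc n pM; have := family_box_normc n p'M; rewrite -/y -/y'; lra.
have y2 n : (n < N)%N -> normc (y n - y' n) <= 2 * d.
  by move=> nN; apply: (normc_ReIm_le (pp' (Ordinal nN, false)) (pp' (Ordinal nN, true))).
(* The bound [2 * d] is charged to every index and [4 * M] added from [N] on, so that both sums are
   geometric. *)
have yt n : normc (y n - y' n) * (K * s ^+ n) <=
    (2 * d) * (K * s ^+ n) + (if (N <= n)%N then 4 * M * (K * s ^+ n) else 0).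
  have Ks : 0 <= K * s ^+ n by rewrite mulr_ge0 ?exprn_ge0.
  case: leqP => Nn.
    apply: (le_trans (ler_wpM2r Ks (y4 n))).
    by rewrite lerDr mulr_ge0// mulr_ge0// ltW.
  by rewrite addr0 ler_wpM2r ?y2.
apply: (le_trans (ler_sum _ (fun n _ => yt (nat_of_ord n)))).
rewrite big_split /=.
have h1 : \sum_(n < m) 2 * d * (K * s ^+ n) <= 2 * d * G.
  rewrite -!mulr_sumr ler_wpM2l// /G ler_wpM2l//.
  by have := sum_geometric_le 0 m s01; rewrite big_mkord expr0 mul1r.
have h2 : \sum_(n < m) (if (N <= n)%N then 4 * M * (K * s ^+ n) else 0)
    <= 4 * M * G * s ^+ N.
  rewrite -big_mkcond -(big_mkord (fun n => (N <= n)%N) (fun n => 4 * M * (K * s ^+ n))).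
  have -> : \sum_(0 <= n < m | (N <= n)%N) 4 * M * (K * s ^+ n) =
      \sum_(N <= n < m) 4 * M * (K * s ^+ n) by rewrite [RHS](big_nat_widenl _ 0%N).
  rewrite -!mulr_sumr -[leRHS]mulrA ler_wpM2l ?mulr_ge0// /G -mulrA ler_wpM2l//.
  by rewrite mulrC; exact: sum_geometric_le.
have h3 : 2 * d * G <= e' / 2.
  have -> : 2 * d * G = e' / 2 * (G / (G + 1)) by rewrite /d; field; rewrite gt_eqF.
  by rewrite ler_piMr ?divr_ge0 ?(ltW e0)// ler_pdivrMr// mul1r lerDl.
rewrite [leRHS](_ : e' = e' / 2 + e' / 2); last by field.
by apply: lerD; [exact: le_trans h1 h3 | exact: le_trans h2 Ns].
Qed.

(** The shift matches f'(z) = sum of (n+1) a_(n+1) z^n; the factor [n.+1] is supplied by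
    [superposition]. *)
Definition composition_operator (f : dirichlet alpha) : dirichlet alpha :=
  dirichlet_superposition (fun n => taylor_coef f n.+1).

Lemma taylor_coef_le (f : dirichlet alpha) n :
  normc (taylor_coef f n) <= seq_norm alpha (taylor_coef f).
Proof. by apply: normc_le_seq_norm alpha01 _; case: (taylor_coefP f). Qed.

Lemma composition_operator_linear : linear composition_operator.
Proof.
move=> c f g; pose M := seq_norm alpha (taylor_coef f) + seq_norm alpha (taylor_coef g).
have M0 : 0 <= M by rewrite addr_ge0 ?seq_norm_ge0.
rewrite /composition_operator taylor_coefD taylor_coefZ.
apply: (dirichlet_superposition_linear c M0) => n.
  by apply: le_trans (taylor_coef_le _ _) _; rewrite lerDl seq_norm_ge0.
by apply: le_trans (taylor_coef_le _ _) _; rewrite lerDr seq_norm_ge0.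
Qed.

HB.instance Definition _ := GRing.isLinear.Build C (dirichlet alpha)
  (dirichlet alpha) *:%R composition_operator composition_operator_linear.

Lemma composition_operatorE (f : dirichlet alpha) z : unit_disc R z ->
  composition_operator f z = composition_differentiation phi f z.
Proof.
move=> zD; have aM n := taylor_coef_le f n.+1.
rewrite (dirichlet_superpositionE (seq_norm_ge0 _ _) aM).
rewrite /superposition_fun asboolT//.
have [d [fd _ fE]] := power_series_derivative (taylor_coefP f).1 (phiD zD).
rewrite /composition_differentiation fE.
by apply: cvg_lim fd; exact: norm_hausdorff.
Qed.

(** Norm-bounded functions have uniformly bounded Taylor coefficients, so their images lie in the
    continuous image of one compact box. *)
Lemma composition_operator_compact : compact_operator composition_operator.
Proof.
move=> A [M0 [M0_real AM]].
have [M M_ge0 fM] : exists2 M : R, 0 <= M &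
    forall f, A f -> seq_norm alpha (taylor_coef f) <= M.
  (* [bounded_set] gives a bound by every number above [M0]; this one is such a number and is
     nonnegative. *)
  exists (`|complex.Re M0| + 1); first by rewrite addr_ge0.
  move=> f Af; have := AM ((`|complex.Re M0| + 1)%:C).
  have -> : M0 < (`|complex.Re M0| + 1)%:C.
    rewrite -(RRe_real M0_real) ltcR.
    by apply: le_lt_trans (ler_norm _) _; rewrite ltrDl.
  move=> /(_ isT f Af) /=; rewrite [X in X <= _]dirichlet_norm_normr.
  by rewrite dirichlet_normE lecR.
have K_compact := continuous_compact (continuous_dirichlet_superposition M_ge0)
  (@family_box_compact M).
have K_precompact := compact_precompact (@norm_hausdorff _ (dirichlet alpha)) K_compact.
apply: precompact_subset K_precompact.
move=> _ [f Af <-].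
(* The point of the box that is sent to the image of [f]. *)
pose p (i : nat * bool) : R :=
  let a := taylor_coef f i.1.+1 in if i.2 then complex.Im a else complex.Re a.
exists p; last first.
  rewrite /composition_operator; congr dirichlet_superposition.
  by apply/funext => n; rewrite /complex_of_family /p /=; case: (taylor_coef f n.+1).
move=> [n c]; rewrite /= in_itv /= -ler_norml.
apply: le_trans (fM f Af); apply: le_trans (taylor_coef_le f n.+1).
by rewrite /p /=; case: c; [exact: Im_normc_le | exact: Re_normc_le].
Qed.

Lemma geometric_composition_differentiation_compact :
  composition_differentiation_compact alpha phi.
Proof.
by exists composition_operator;
  [exact: composition_operatorE | exact: composition_operator_compact].
Qed.

End Operator.

(** * Geometric decay of the powers of the symbol *)

(** The values of a self-map have modulus below 1, so the supremum is taken over a bounded set. *)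
Lemma disc_sup_norm_bound (R : realType) (phi : R[i] -> R[i]) z :
  analytic_self_map phi -> unit_disc R z -> normc (phi z) <= disc_sup_norm phi.
Proof.
move=> [_ phiD] zD; apply: ub_le_sup; last by exists z.
by exists 1 => _ [w wD <-]; have := phiD _ wD; rewrite disc_normc => /ltW.
Qed.

(** The division by [r ^+ 2] in [D] turns n r^(n-1) into n r^n, so the [n]-th power has norm at most
    D (n+1) r^n; [natr2_geometric_le] then absorbs (n+1)^2. *)
Lemma power_coef_geometric (R : realType) (alpha r : R) (g : R[i] -> R[i])
    (b : nat -> R[i]) : 0 < alpha < 1 -> 0 < r < 1 ->
  power_series_on_disc g b -> square_summable alpha b ->
  (forall z, unit_disc R z -> normc (g z) <= r) ->
  exists K s, [/\ 0 <= K, 0 <= s < 1 &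
    forall n, square_summable alpha (power_coef b n) /\
      n.+1%:R * seq_norm alpha (power_coef b n) <= K * s ^+ n].
Proof.
move=> alpha01 /andP[r0 r1] gb sb gr.
have r01 : 0 <= r < 1 by rewrite ltW.
have [K [s [K0 s01 Ks]]] := natr2_geometric_le r01.
pose S := seq_sqnorm alpha b; pose D := Num.sqrt (1 + S / r ^+ 2).
have S0 : 0 <= S by exact: seq_sqnorm_ge0.
have Sr0 : 0 <= S / r ^+ 2 by rewrite divr_ge0 ?sqr_ge0.
exists (D * K), s; split=> // [|n]; first by rewrite mulr_ge0 ?sqrtr_ge0.
have [sbn nbn] := power_coef_sqnorm alpha01 n gb sb gr.
split=> //; have : seq_norm alpha (power_coef b n) <= D * (n.+1%:R * r ^+ n).
  have X0 : 0 <= n.+1%:R * r ^+ n by rewrite mulr_ge0 ?exprn_ge0 ?ltW.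
  apply: seq_norm_le; first by rewrite mulr_ge0 ?sqrtr_ge0.
  apply: le_trans nbn _; rewrite [leRHS]exprMn sqr_sqrtr ?addr_ge0// mulrDl mul1r.
  apply: lerD.
    by rewrite exprMn ler_peMl ?sqr_ge0// exprn_ege1// ler1n.
  rewrite -/S; case: (n) => [|m].
    by rewrite mul0r expr0n mul0r mulr_ge0 ?sqr_ge0.
  rewrite /= [S / _]mulrC [leRHS]mulrAC ler_wpM2r// ler_pdivlMl ?exprn_gt0//.
  rewrite -exprMn mulrCA -exprS lerXn2r ?nnegrE ?mulr_ge0 ?exprn_ge0 ?(ltW r0)//.
  by rewrite ler_wpM2r ?exprn_ge0 ?(ltW r0)// ler_nat.
move=> h; apply: (le_trans (ler_wpM2l (ler0n _ _) h)).
rewrite mulrCA -[leRHS]mulrA ler_wpM2l ?sqrtr_ge0// mulrA -expr2; exact: Ks.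
Qed.

Theorem proposition3p8 (R : realType) (alpha : R) (alpha01 : 0 < alpha < 1)
    (phi : R[i] -> R[i])
    (phi_dirichlet : in_dirichlet alpha phi)
    (phi_self : analytic_self_map phi)
    (phi_sup : disc_sup_norm phi < 1) :
  composition_differentiation_compact alpha phi.
Proof.
have [_ [b phib sb]] := phi_dirichlet; have [_ phiD] := phi_self.
have D0 : unit_disc R 0 by rewrite disc_normc ComplexField.Normc.normc0 ltr01.
have sup0 : 0 <= disc_sup_norm phi.
  exact: le_trans (normc_ge0 _) (disc_sup_norm_bound phi_self D0).
(* The midpoint between the supremum and 1 is positive even when the supremum is 0, so division by
   [r] is allowed. *)
pose r := (1 + disc_sup_norm phi) / 2.
have r01 : 0 < r < 1 by apply/andP; split; rewrite /r; lra.
have phir z : unit_disc R z -> normc (phi z) <= r.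
  by move=> /(disc_sup_norm_bound phi_self) zr; rewrite /r; lra.
have [K [s [K0 s01 Ks]]] := power_coef_geometric alpha01 r01 phib sb phir.
have sbn n := (Ks n).1; have nbn n := (Ks n).2.
exact: (geometric_composition_differentiation_compact alpha01 phib phiD K0 s01 sbn nbn).
Qed.
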